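(* Let $p\colon E\to B$ be a locally trivial fiber bundle with fiber $F$ such that (a) the total space $E$, the base $B$ and the fiber $F$ are homeomorphic to definable sets, and (b) $B$ is compact. Then $\chi(E)=\chi(B)\cdot\chi(F)$.
   Context: An o-minimal structure over $\mathbb{R}$ is a collection $\mathcal{A}=\{\mathcal{A}_n\}_{n\in\mathbb{N}}$, where each $\mathcal{A}_n$ is an algebra of subsets of $\mathbb{R}^n$, such that: (1) $A\in\mathcal{A}_n$, $B\in\mathcal{A}_m$ imply $A\times B\in\mathcal{A}_{n+m}$; (2) $A\in\mathcal{A}_n$ implies $\pi(A)\in\mathcal{A}_{n-1}$, where $\pi$ is the projection onto the first $n-1$ coordinates; (3) $\{x\in\mathbb{R}^n: x_i=x_j\}\in\mathcal{A}_n$ for all $1\le i<j\le n$; (4) $\{(x,y)\in\mathbb{R}^2: x<y\}\in\mathcal{A}_2$; (5) $\mathcal{A}_1$ is the collection of finite unions of points and open intervals of $\mathbb{R}$. Fix such a structure; a set $A\subset\mathbb{R}^n$ is definable if $A\in\mathcal{A}_n$, and a map between definable sets is definable if its graph is definable. An open $n$-simplex is the set $\{\sum_i t_iv_i: \sum_i t_i=1,\ t_i>0\}$ for affinely independent points $v_0,\dots,v_n\in\mathbb{R}^m$. A generalized simplicial complex is a finite collection $\mathcal{K}$ of open simplices in some $\mathbb{R}^n$ such that the closures of any two of them intersect either in the empty set or in the closure of a common face of both (the open face itself is not required to belong to $\mathcal{K}$). $|\mathcal{K}|$ denotes the union of its open simplices. Its Euler-Poincaré characteristic is $\chi(\mathcal{K})=\sum_i(-1)^ic_i$,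 where $c_i$ is the number of open $i$-simplices of $\mathcal{K}$. A triangulation of a topological space $X$ is a homeomorphism $|\mathcal{K}|\to X$; it is compatible with a subset of $X$ if that subset is a union of images of open simplices of $\mathcal{K}$. Standing framework: (i) (definable triangulation theorem) for every definable set $X$ and every finite family of definable subsets of $X$ there is a definable triangulation of $X$ compatible with all members of the family; the Euler-Poincaré characteristic $\chi(X)$ of a definable set is the characteristic of the generalized simplicial complex of a definable triangulation; (ii) (Beke) homeomorphic definable sets have equal characteristic, even if the homeomorphism is not definable. For a topological space $X$ homeomorphic (by any homeomorphism) to a definable set $A$, its Euler-Poincaré characteristic is $\chi(X):=\chi(A)$, which is well defined by (ii). This combinatorial characteristic is not a homotopy invariant in general; e.g. an open $n$-simplex has characteristic $(-1)^n$. *)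

(* Defs.v *)
From HB Require Import structures.
From mathcomp Require Import all_boot all_order all_algebra.
From mathcomp Require Import finmap.
From mathcomp Require Import all_classical all_reals all_analysis.

Set Implicit Arguments.
Unset Strict Implicit.
Unset Printing Implicit Defensive.

Import Order.TTheory GRing.Theory Num.Theory.
Import numFieldNormedType.Exports.
Local Open Scope classical_set_scope.
Local Open Scope ring_scope.

(* A set [A] used as a type is [set_type A], with its subset topology. *)

Definition homeomorphism (X Y : topologicalType) (f : X -> Y) : Prop :=
  exists g : Y -> X, [/\ cancel f g, cancel g f, continuous f & continuous g].

Definition homeomorphic (X Y : topologicalType) : Prop :=
  exists f : X -> Y, homeomorphism f.

Definition locally_trivial_bundle (E B F : topologicalType) (p : E -> B) : Prop :=
  continuous p /\
  forall b : B, exists U : set B,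
    [/\ open U, U b &
      exists h : set_type (p @^-1` U) -> (set_type U * F)%type,
        homeomorphism h /\ forall e, set_val (h e).1 = p (set_val e)].

(* The endpoints are extended reals, so rays and the whole line are open
   intervals: they must be, as the definable sets are closed under complement. *)
Definition point_or_open_interval (R : realType) (I : set R) : Prop :=
  (exists a : R, I = [set a]) \/
  (exists a b : \bar R, I = [set x : R | (a < x%:E)%E /\ (x%:E < b)%E]).

Definition finite_union_points_intervals (R : realType) (D : set R) : Prop :=
  exists G : set (set R),
    [/\ finite_set G, G `<=` @point_or_open_interval R &
        D = \bigcup_(I in G) I].

Record o_minimal_structure (R : realType) := OMinimalStructure {
  definable : forall n : nat, set (set 'rV[R]_n);
  definable_set0 : forall n, @definable n set0;
  definable_setC : forall n (A : set 'rV[R]_n),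
    definable A -> definable (~` A);
  definable_setU : forall n (A B : set 'rV[R]_n),
    definable A -> definable B -> definable (A `|` B);
  definable_setX : forall n m (A : set 'rV[R]_n) (B : set 'rV[R]_m),
    definable A -> definable B ->
    definable [set z : 'rV[R]_(n + m) | A (lsubmx z) /\ B (rsubmx z)];
  definable_proj : forall n (A : set 'rV[R]_(n + 1)),
    definable A -> definable ((fun z => lsubmx z) @` A);
  definable_diag : forall n (i j : 'I_n), (i < j)%N ->
    definable [set x : 'rV[R]_n | x 0 i = x 0 j];
  definable_lt : definable [set x : 'rV[R]_2 | x 0 0 < x 0 1];
  definable_line : forall A : set 'rV[R]_1,
    definable A <-> finite_union_points_intervals [set x 0 0 | x in A]
}.

Definition graph (R : realType) (n m : nat) (A : set 'rV[R]_n)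
    (B : set 'rV[R]_m) (f : set_type A -> set_type B) : set 'rV[R]_(n + m) :=
  [set row_mx (set_val a) (set_val (f a)) | a in [set: set_type A]].

Definition definable_map (R : realType) (S : o_minimal_structure R) (n m : nat)
    (A : set 'rV[R]_n) (B : set 'rV[R]_m) (f : set_type A -> set_type B) : Prop :=
  [/\ definable S A, definable S B & definable S (graph f)].

Definition affinely_independent (R : realType) (N k : nat)
    (v : 'I_k -> 'rV[R]_N) : Prop :=
  forall t : 'I_k -> R,
    \sum_i t i = 0 -> \sum_i t i *: v i = 0 -> forall i, t i = 0.

Definition open_hull (R : realType) (N k : nat) (v : 'I_k -> 'rV[R]_N) :
    set 'rV[R]_N :=
  [set x | exists t : 'I_k -> R,
    [/\ \sum_i t i = 1, forall i, 0 < t i & x = \sum_i t i *: v i]].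

Definition open_simplex (R : realType) (N d : nat) (s : set 'rV[R]_N) : Prop :=
  exists v : 'I_d.+1 -> 'rV[R]_N, affinely_independent v /\ s = open_hull v.

(* The vertices of [r] are some of those of [s]; [r = s] is allowed. *)
Definition open_face (R : realType) (N : nat) (r s : set 'rV[R]_N) : Prop :=
  exists (d : nat) (v : 'I_d.+1 -> 'rV[R]_N) (c : nat) (i : 'I_c.+1 -> 'I_d.+1),
    [/\ affinely_independent v, s = open_hull v, injective i &
        r = open_hull (v \o i)].

Definition generalized_complex (R : realType) (N : nat)
    (K : set (set 'rV[R]_N)) : Prop :=
  [/\ finite_set K,
      forall s, K s -> exists d, open_simplex d s &
      forall s t, K s -> K t ->
        closure s `&` closure t = set0 \/
        exists r, [/\ open_face r s, open_face r t &
                      closure s `&` closure t = closure r]].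

Definition realization (R : realType) (N : nat) (K : set (set 'rV[R]_N)) :
    set 'rV[R]_N := \bigcup_(s in K) s.

(* Dimensions above [N] do not occur: at most [N.+1] points of R^N are affinely
   independent. *)
Definition complex_euler_char (R : realType) (N : nat)
    (K : set (set 'rV[R]_N)) : int :=
  \sum_(i < N.+1) (-1) ^+ i * (#|` fset_set [set s | K s /\ open_simplex i s]|)%:Z.

Definition definable_triangulation (R : realType) (S : o_minimal_structure R)
    (N n : nat) (K : set (set 'rV[R]_N)) (X : set 'rV[R]_n)
    (h : set_type (realization K) -> set_type X) : Prop :=
  [/\ generalized_complex K, homeomorphism h & definable_map S h].

Definition compatible_triangulation (R : realType) (N n : nat)
    (K : set (set 'rV[R]_N)) (X : set 'rV[R]_n)
    (h : set_type (realization K) -> set_type X) (Y : set 'rV[R]_n) : Prop :=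
  exists L : set (set 'rV[R]_N), L `<=` K /\
    Y = \bigcup_(s in L) [set set_val (h x) | x in [set x | s (set_val x)]].

Definition has_definable_euler_char (R : realType) (S : o_minimal_structure R)
    (n : nat) (X : set 'rV[R]_n) (c : int) : Prop :=
  exists (N : nat) (K : set (set 'rV[R]_N))
         (h : set_type (realization K) -> set_type X),
    definable_triangulation S h /\ complex_euler_char K = c.

(* This does not follow from the record [o_minimal_structure]: it fails for the
   pure order structure (R, <), in which R is not definably homeomorphic to any
   bounded set. *)
Definition definable_triangulation_theorem (R : realType)
    (S : o_minimal_structure R) : Prop :=
  forall (n : nat) (X : set 'rV[R]_n) (Y : set (set 'rV[R]_n)),
    definable S X -> finite_set Y ->
    (forall A, Y A -> definable S A /\ A `<=` X) ->
    exists (N : nat) (K : set (set 'rV[R]_N))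
           (h : set_type (realization K) -> set_type X),
      definable_triangulation S h /\
      forall A, Y A -> compatible_triangulation h A.

(* With [X = Y] this includes independence of the triangulation. *)
Definition euler_char_invariance (R : realType) (S : o_minimal_structure R) : Prop :=
  forall (n m : nat) (X : set 'rV[R]_n) (Y : set 'rV[R]_m) (c d : int),
    homeomorphic (set_type X) (set_type Y) ->
    has_definable_euler_char S X c -> has_definable_euler_char S Y d -> c = d.

Definition homeomorphic_to_definable (R : realType) (S : o_minimal_structure R)
    (X : topologicalType) : Prop :=
  exists (n : nat) (A : set 'rV[R]_n),
    definable S A /\ homeomorphic X (set_type A).

(* The default value 0 is taken only when no such [A] exists; see
   [euler_charE] and [euler_char_exists]. *)
Definition euler_char (R : realType) (S : o_minimal_structure R)
    (X : topologicalType) : int :=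
  xget 0 [set c | exists (n : nat) (A : set 'rV[R]_n),
    [/\ definable S A, homeomorphic X (set_type A) &
        has_definable_euler_char S A c]].

Lemma homeomorphic_sym (X Y : topologicalType) :
  homeomorphic X Y -> homeomorphic Y X.
Proof. by move=> [f [g [fK gK cf cg]]]; exists g, f. Qed.

Lemma homeomorphic_trans (X Y Z : topologicalType) :
  homeomorphic X Y -> homeomorphic Y Z -> homeomorphic X Z.
Proof.
move=> [f [f' [fK fK' cf cf']]] [g [g' [gK gK' cg cg']]].
exists (g \o f), (f' \o g'); split.
- exact: can_comp.
- exact: can_comp.
- by move=> x; apply: continuous_comp; [exact: cf|exact: cg].
- by move=> x; apply: continuous_comp; [exact: cg'|exact: cf'].
Qed.

Lemma euler_charE (R : realType) (S : o_minimal_structure R)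
    (X : topologicalType) (n : nat) (A : set 'rV[R]_n) (c : int) :
  euler_char_invariance S -> definable S A -> homeomorphic X (set_type A) ->
  has_definable_euler_char S A c -> euler_char S X = c.
Proof.
move=> inv dA XA Ac; rewrite /euler_char.
case: xgetP => [d -> [m [B [dB XB Bd]]]|/(_ c)[]]; last by exists n, A.
exact: (inv _ _ _ _ _ _ (homeomorphic_trans (homeomorphic_sym XB) XA) Bd Ac).
Qed.

Lemma euler_char_exists (R : realType) (S : o_minimal_structure R)
    (n : nat) (A : set 'rV[R]_n) :
  definable_triangulation_theorem S -> definable S A ->
  exists c, has_definable_euler_char S A c.
Proof.
move=> tri dA; have [//|N [K [h [hK _]]]] := tri n A set0 dA (finite_set0 _).
by exists (complex_euler_char K), N, K, h.
Qed.

(* Main.v *)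
Require Import Defs.
From mathcomp Require Import all_boot all_order all_algebra.
From mathcomp Require Import finmap.
From mathcomp Require Import all_classical all_reals all_analysis.
From mathcomp Require Import ring lra zify.

(* The proof replaces the combinatorial characteristic of a locally compact
   space by the Euler characteristic of its Alexander-Spanier cohomology with
   compact supports. The latter is defined for any topological space, so it can
   be cut along pieces that are not definable: it is additive for a closed set
   and its complement, it vanishes on [0, oo) x Y, hence is multiplied by
   (-1)^d by an open d-simplex factor, and for a realization |K| it equals the
   characteristic of K. If F is locally compact, and the open simplices of B are
   so small that the bundle is trivial over each of them, additivity over the
   preimages of these simplices gives the product formula.

   In general, the points at which |K| is locally compact form a union of open
   simplices of K. As B is compact, those of E form a bundle over B whose fiber
   consists of those of F, and so do the remaining points; removing these
   parts from E and F simultaneously, one concludes by induction. *)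

Set Implicit Arguments.
Unset Strict Implicit.
Unset Printing Implicit Defensive.

Import Order.TTheory GRing.Theory Num.Theory.
Import numFieldNormedType.Exports.
Local Open Scope classical_set_scope.
Local Open Scope ring_scope.

(** * Dimensions of quotient spaces *)

(** Local compactness is indispensable for additivity: a cochain is extended by zero from the
    complement of a closed set after being cut off to a compact neighbourhood of its support. A
    realization |K| may lack such neighbourhoods because faces may be missing, as in an open
    triangle together with one of its vertices; hence the induction over locally compact parts. It
    terminates because simplices of maximal dimension are open in |L|, so the locally compact part
    of a nonempty fiber is nonempty. Compactness of B enters twice. A Lebesgue number makes the
    simplices of a fine triangulation of B lie in trivializing open sets. And since B is locally
    compact, E is locally compact at a point exactly when F is so at its fiber coordinate, whatever
    trivialization is used; this is why both parts of E are bundles again. That cohomology is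
    finite-dimensional is not known beforehand. Hence [has_chi] is a relation that includes this
    claim, and each additivity lemma proves it for the remaining space. *)

Section Subspaces.
Variables (k : fieldType) (V : lmodType k).

Definition subspace (Z : set V) : Prop :=
  Z 0 /\ forall (a : k) (x y : V), Z x -> Z y -> Z (a *: x + y).

Variables (Z : set V) (Zs : subspace Z).

Lemma subspace0 : Z 0. Proof. by case: Zs. Qed.

Lemma subspaceD x y : Z x -> Z y -> Z (x + y).
Proof. by move=> Zx Zy; rewrite -[x]scale1r; apply: Zs.2. Qed.

Lemma subspaceZ a x : Z x -> Z (a *: x).
Proof. by move=> Zx; rewrite -[_ *: x]addr0; apply: Zs.2 => //; case: Zs. Qed.

Lemma subspaceN x : Z x -> Z (- x).
Proof. by move=> Zx; rewrite -scaleN1r; apply: subspaceZ. Qed.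

Lemma subspaceB x y : Z x -> Z y -> Z (x - y).
Proof. by move=> Zx Zy; apply: subspaceD => //; apply: subspaceN. Qed.

Lemma subspace_sum n (c : 'I_n -> k) (e : 'I_n -> V) :
  (forall i, Z (e i)) -> Z (\sum_i c i *: e i).
Proof.
move=> Ze; apply: (@big_ind _ Z) => [|x y|i _]; first exact: subspace0.
- exact: subspaceD.
- exact: subspaceZ.
Qed.

Lemma subspace_addl x y : Z y -> Z (x + y) <-> Z x.
Proof.
by move=> Zy; split=> [/subspaceB/(_ Zy)|/subspaceD]; [rewrite addrK|apply].
Qed.

End Subspaces.

Lemma subspaceI (k : fieldType) (V : lmodType k) (Z Z' : set V) :
  subspace Z -> subspace Z' -> subspace (Z `&` Z').
Proof.
move=> Zs Zs'; split; first by split; exact: subspace0.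
by move=> a x y [Zx Zx'] [Zy Zy']; split; [apply: Zs.2|apply: Zs'.2].
Qed.

Section QuotientDim.
Variables (k : fieldType) (V : lmodType k).
Implicit Types (Z B M : set V).

Definition free_mod B n (e : 'I_n -> V) : Prop :=
  forall c : 'I_n -> k, B (\sum_i c i *: e i) -> forall i, c i = 0.

(** This is the dimension of Z / (Z cap B), given by a basis modulo [B] so that no quotient is
    formed. It is a relation because the dimension may be infinite. *)
Definition quot_dim Z B (n : nat) : Prop :=
  exists e : 'I_n -> V, [/\ forall i, Z (e i), free_mod B e &
    forall z, Z z -> exists c : 'I_n -> k, B (z - \sum_i c i *: e i)].

(** The coordinates of the [f i] modulo [B] form an m x n matrix. A row vector killing it is a
    relation among the [f i] modulo [B], so the matrix has rank m. *)
Lemma free_mod_leq Z B m n (f : 'I_m -> V) : subspace B -> quot_dim Z B n ->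
  (forall i, Z (f i)) -> free_mod B f -> (m <= n)%N.
Proof.
move=> Bs [e [Ze fe se]] Zf ff.
have [C HC] := choice (fun i => se (f i) (Zf i)).
pose A : 'M[k]_(m, n) := \matrix_(i, j) C i j.
suff : row_free A by move=> /eqP <-; exact: rank_leq_col.
apply: inj_row_free => v vA.
apply/rowP => i; rewrite mxE; apply: (ff (fun i => v 0 i)).
have -> : \sum_i v 0 i *: f i =
    \sum_i v 0 i *: (f i - \sum_j C i j *: e j).
  rewrite [RHS](eq_bigr (fun i => v 0 i *: f i - \sum_j v 0 i *: (C i j *: e j))).
    rewrite sumrB [X in _ - X]exchange_big /= [X in _ - X]big1 ?subr0 // => j _.
    have /rowP/(_ j) := vA; rewrite !mxE => vj.
    rewrite -[RHS](scale0r (e j)) -vj scaler_suml.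
    by apply: eq_bigr => a _; rewrite scalerA !mxE.
  by move=> a _; rewrite scalerBr scaler_sumr.
exact: subspace_sum.
Qed.

Lemma quot_dim_uniq Z B m n :
  subspace B -> quot_dim Z B m -> quot_dim Z B n -> m = n.
Proof.
move=> Bs Hm Hn; apply/eqP; rewrite eqn_leq.
move: (Hm) (Hn) => [e [Ze fe _]] [f [Zf ff _]].
by rewrite (free_mod_leq Bs Hn Ze fe) (free_mod_leq Bs Hm Zf ff).
Qed.

(** A free family of maximal length spans, as a vector outside its span could be added to it. This
    is how subquotients inherit finite dimension. *)
Lemma quot_dim_bounded Z B N : subspace B ->
  (forall m (f : 'I_m -> V),
     (forall i, Z (f i)) -> free_mod B f -> (m <= N)%N) ->
  exists n, quot_dim Z B n.
Proof.
move=> Bs bnd.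
pose P m := `[< exists f : 'I_m -> V, (forall i, Z (f i)) /\ free_mod B f >].
have exP : exists m, P m.
  by exists 0%N; apply/asboolP; exists (fun=> 0); split=> [|c _] [].
have bP m : P m -> (m <= N)%N by move=> /asboolP[f [Zf ff]]; exact: bnd Zf ff.
case: (ex_maxnP exP bP) => n /asboolP[e [Ze fe]] nmax.
exists n, e; split=> // z Zz; apply: contrapT => nspan.
pose e' (i : 'I_n.+1) := oapp e z (unlift ord0 i).
suff : P n.+1 by move=> /nmax; rewrite ltnn.
apply/asboolP; exists e'; split.
  by move=> i; rewrite /e'; case: unliftP => [j _|_] /=.
move=> c; rewrite big_ord_recl /e' unlift_none /=.
under eq_bigr => i _ do rewrite liftK /=.
have [c0|c0] := eqVneq (c ord0) 0.
  rewrite c0 scale0r add0r => /fe ce i.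
  by case: (unliftP ord0 i) => [j ->|->].
move=> Bc; case: nspan; exists (fun i => - ((c ord0)^-1 * c (lift ord0 i))).
have := subspaceZ Bs (c ord0)^-1 Bc.
rewrite scalerDr scalerA mulVf // scale1r scaler_sumr -sumrN.
congr B; congr (_ + _); apply: eq_bigr => i _.
by rewrite scaleNr opprK scalerA.
Qed.

Lemma quot_dim_add Z M B m p : subspace M -> subspace B ->
  B `<=` M -> M `<=` Z ->
  quot_dim M B m -> quot_dim Z M p -> quot_dim Z B (m + p).
Proof.
move=> Ms Bs BM MZ [e [Me fe se]] [f [Zf ff sf]].
pose g (i : 'I_(m + p)) : V :=
  match fintype.split i with inl a => e a | inr a => f a end.
have gl i : g (lshift p i) = e i by rewrite /g (unsplitK (inl i)).
have gr i : g (rshift m i) = f i by rewrite /g (unsplitK (inr i)).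
have gsum (c : 'I_(m + p) -> k) : \sum_i c i *: g i =
    \sum_i c (lshift p i) *: e i + \sum_i c (rshift m i) *: f i.
  rewrite big_split_ord /=; congr (_ + _); apply: eq_bigr => i _.
  - by rewrite gl.
  - by rewrite gr.
exists g; split.
- by move=> i; rewrite /g; case: fintype.split => a //; exact/MZ/Me.
- move=> c; rewrite gsum => Bc.
  have cr : forall i, c (rshift m i) = 0.
    apply: ff; rewrite -(@subspace_addl _ _ _ Ms _ (\sum_i c (lshift p i) *: e i)).
      by rewrite addrC; exact: BM.
    exact: subspace_sum.
  have cl : forall i, c (lshift p i) = 0.
    apply: fe; move: Bc; rewrite [X in _ + X]big1 ?addr0 // => i _.
    by rewrite cr scale0r.
  by move=> i; rewrite -[i]splitK; case: fintype.split => a /=.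
- move=> z /sf[c Mc]; have [c' Bc'] := se _ Mc.
  exists (fun i => match fintype.split i with inl a => c' a | inr a => c a end).
  rewrite gsum; move: Bc'; congr B.
  under [in RHS]eq_bigr => i _ do rewrite (unsplitK (inl i)).
  under [X in _ = _ - (_ + X)]eq_bigr => i _ do rewrite (unsplitK (inr i)).
  by rewrite opprD addrA addrAC.
Qed.

Lemma quot_dim_split Z M B n : subspace M -> subspace B ->
  B `<=` M -> M `<=` Z -> quot_dim Z B n ->
  exists m p, [/\ quot_dim M B m, quot_dim Z M p & n = (m + p)%N].
Proof.
move=> Ms Bs BM MZ dn.
have [m dm] : exists m, quot_dim M B m.
  apply: (quot_dim_bounded (N := n) Bs) => m f Mf ff.
  by apply: (free_mod_leq Bs dn _ ff) => i; exact/MZ/Mf.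
have [p dp] : exists p, quot_dim Z M p.
  apply: (quot_dim_bounded (N := n) Ms) => p f Zf ff.
  by apply: (free_mod_leq Bs dn Zf) => c /BM/ff.
exists m, p; split=> //.
exact: (quot_dim_uniq Bs dn (quot_dim_add Ms Bs BM MZ dm dp)).
Qed.

End QuotientDim.

Section QuotientIso.
Variables (k : fieldType) (V W : lmodType k).
Variables (Z1 B1 : set V) (Z2 B2 : set W) (phi : V -> W).
Hypotheses (Z1s : subspace Z1) (B2s : subspace B2).
Hypothesis phi_lin :
  forall (a : k) x y, phi (a *: x + y) = a *: phi x + phi y.
Hypothesis Zphi : forall z, Z1 z -> Z2 (phi z).
Hypothesis phi_onto : forall w, Z2 w -> exists z, Z1 z /\ B2 (w - phi z).
Hypothesis phi_ker : forall z, Z1 z -> B2 (phi z) <-> B1 z.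

Let phi0 : phi 0 = 0.
Proof. by have := phi_lin (-1) 0 0; rewrite scaler0 addr0 scaleN1r addNr. Qed.

Let phi_sum n (c : 'I_n -> k) (e : 'I_n -> V) :
  phi (\sum_i c i *: e i) = \sum_i c i *: phi (e i).
Proof.
elim: n c e => [|n IHn] c e; first by rewrite !big_ord0.
by rewrite !big_ord_recl phi_lin IHn.
Qed.

Let phiB x y : phi (x - y) = phi x - phi y.
Proof. by rewrite addrC -scaleN1r phi_lin scaleN1r addrC. Qed.

(** Only the induced map Z1/B1 -> Z2/B2 has to be bijective. In the applications [phi] is the
    identity, the coboundary (for the connecting map) or a pullback. *)
Lemma quot_dim_iso n : quot_dim Z1 B1 n <-> quot_dim Z2 B2 n.
Proof.
split=> [[e [Ze fe se]]|[e [Ze fe se]]].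
- exists (phi \o e); split=> [i|c|w /phi_onto[z [Zz Bz]]] /=.
  + exact: Zphi.
  + by rewrite -phi_sum phi_ker; [exact: fe|exact: subspace_sum].
  + have [c Bc] := se z Zz; exists c; rewrite -phi_sum.
    rewrite -(subrKA (phi z)) -phiB; apply: subspaceD => //.
    rewrite phi_ker //; apply: subspaceB => //; exact: subspace_sum.
- have [f Hf] := choice (fun i => phi_onto (Ze i)).
  have Bf (c : 'I_n -> k) :
      B2 (phi (\sum_i c i *: f i) - \sum_i c i *: e i).
    rewrite phi_sum -opprB; apply: subspaceN => //; rewrite -sumrB.
    under eq_bigr => i _ do rewrite -scalerBr.
    by apply: subspace_sum => // i; case: (Hf i).
  have Zf i : Z1 (f i) by case: (Hf i).
  exists f; split=> // [c|z Zz].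
  + rewrite -phi_ker; last exact: subspace_sum.
    move=> Bc; apply: fe; rewrite -[X in B2 X]opprK; apply: subspaceN => //.
    rewrite -(@subspace_addl _ _ _ B2s _ (phi (\sum_i c i *: f i))) // addrC.
    exact: Bf.
  + have [c Bc] := se _ (Zphi Zz); exists c.
    rewrite -phi_ker; last by apply: subspaceB => //; exact: subspace_sum.
    rewrite phiB -(@subspace_addl _ _ _ B2s _ _ (Bf c)) subrKA //.
Qed.

End QuotientIso.

(** * Euler characteristics of cochain complexes *)

Section EulerCharOfComplexes.
Variables (k : fieldType) (V : lmodType k) (d : V -> V).
Hypothesis d_lin : forall (a : k) x y, d (a *: x + y) = a *: d x + d y.
Hypothesis dd : forall x, d (d x) = 0.
Implicit Types C N : bool -> set V.

Let d0 : d 0 = 0.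
Proof. by have := d_lin (-1) 0 0; rewrite scaler0 addr0 scaleN1r addNr. Qed.

Let dD x y : d (x + y) = d x + d y.
Proof. by rewrite -[x]scale1r d_lin !scale1r. Qed.

Let dN x : d (- x) = - d x.
Proof. by have := d_lin (-1) x 0; rewrite !addr0 d0 addr0 !scaleN1r. Qed.

Let dB x y : d (x - y) = d x - d y.
Proof. by rewrite dD dN. Qed.

(** The grading is by parity only. This suffices for an Euler characteristic, and long exact
    sequences close up to hexagons. *)
Definition subcomplex C : Prop :=
  forall b, subspace (C b) /\ forall x, C b x -> C (~~ b) (d x).

Definition cycles C N b : set V := [set x | C b x /\ N (~~ b) (d x)].

Definition boundaries C N b : set V :=
  [set x | exists y n, [/\ C (~~ b) y, N b n & x = d y + n]].

(* The cohomology of [C / N], where [N] is a subcomplex of [C]. *)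
Definition cohomology_dim C N b n : Prop :=
  quot_dim (cycles C N b) (boundaries C N b) n.

(* [C true] are the cochains of even degree: those on simplices with an odd
   number of vertices. *)
Definition complex_chi C N (c : int) : Prop :=
  exists h : bool -> nat, (forall b, cohomology_dim C N b (h b)) /\
    c = (h true)%:Z - (h false)%:Z.

Lemma cycles_subspace C N b :
  subcomplex C -> subcomplex N -> subspace (cycles C N b).
Proof.
move=> Cs Ns; have [Cb _] := Cs b; have [Nb _] := Ns (~~ b).
split=> [|a x y [Cx Nx] [Cy Ny]].
  by split; [exact: subspace0|rewrite d0; exact: subspace0].
by split; [apply: Cb.2|rewrite d_lin; apply: Nb.2].
Qed.

Lemma boundaries_subspace C N b :
  subcomplex C -> subcomplex N -> subspace (boundaries C N b).
Proof.
move=> Cs Ns; have [Cb _] := Cs (~~ b); have [Nb _] := Ns b.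
split.
  by exists 0, 0; split; [exact: subspace0|exact: subspace0|rewrite d0 addr0].
move=> a _ _ [y [n [Cy Nn ->]]] [y' [n' [Cy' Nn' ->]]].
exists (a *: y + y'), (a *: n + n'); split; [exact: Cb.2|exact: Nb.2|].
by rewrite d_lin scalerDr addrACA.
Qed.

Lemma boundaries_cycles C N b : subcomplex C -> subcomplex N ->
  (forall b, N b `<=` C b) -> boundaries C N b `<=` cycles C N b.
Proof.
move=> Cs Ns NC _ [y [n [Cy Nn ->]]]; split.
  apply: subspaceD; [exact: (Cs b).1| |exact: NC].
  by have := (Cs (~~ b)).2 y Cy; rewrite negbK.
by rewrite dD dd add0r; apply: (Ns b).2.
Qed.

Lemma complex_chi_uniq C N c c' : subcomplex C -> subcomplex N ->
  complex_chi C N c -> complex_chi C N c' -> c = c'.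
Proof.
move=> Cs Ns [h [Hh ->]] [h' [Hh' ->]].
suff E b : h b = h' b by rewrite !E.
by apply: quot_dim_uniq (Hh b) (Hh' b); exact: boundaries_subspace.
Qed.

Lemma complex_chi0 C N : subcomplex C -> subcomplex N ->
  (forall b x, C b x -> N (~~ b) (d x) -> boundaries C N b x) ->
  complex_chi C N 0.
Proof.
move=> Cs Ns acyclic; exists (fun=> 0%N); split=> // b.
exists (fun=> 0); split=> [[]|c _ []|x [Cx Nx]] //.
by exists (fun=> 0); rewrite big_ord0 subr0; exact: acyclic.
Qed.

Section Triple.
Variables (C C' N : bool -> set V).
Hypotheses (Cs : subcomplex C) (C's : subcomplex C') (Ns : subcomplex N).
Hypotheses (NC' : forall b, N b `<=` C' b) (C'C : forall b, C' b `<=` C b).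

Let NC b : N b `<=` C b := fun x Nx => C'C (NC' Nx).

(* The images of the three maps of the exact hexagon
   H(C'/N) -> H(C/N) -> H(C/C') -> H(C'/N). *)
Let M1 b := cycles C' N b `&` boundaries C N b.
Let M2 b : set V :=
  [set x | exists z y, [/\ cycles C' N b z, C (~~ b) y & x = z + d y]].
Let M3 b : set V :=
  [set x | exists z y, [/\ cycles C N b z, C' b y & x = z + y]].

Let dC b x : C (~~ b) x -> C b (d x).
Proof. by move=> /((Cs (~~ b)).2); rewrite negbK. Qed.

Let dC' b x : C' (~~ b) x -> C' b (d x).
Proof. by move=> /((C's (~~ b)).2); rewrite negbK. Qed.

Let M1s b : subspace (M1 b).
Proof. by apply: subspaceI; [exact: cycles_subspace|exact: boundaries_subspace]. Qed.

Let M2s b : subspace (M2 b).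
Proof.
have Zs := cycles_subspace b C's Ns; have [Cb _] := Cs (~~ b).
split.
  by exists 0, 0; split; [exact: subspace0|exact: subspace0|rewrite d0 addr0].
move=> a _ _ [y [n [Cy Nn ->]]] [y' [n' [Cy' Nn' ->]]].
exists (a *: y + y'), (a *: n + n'); split; [exact: Zs.2|exact: Cb.2|].
by rewrite d_lin scalerDr addrACA.
Qed.

Let M3s b : subspace (M3 b).
Proof.
have Zs := cycles_subspace b Cs Ns; have [Cb _] := C's b.
split.
  by exists 0, 0; split; [exact: subspace0|exact: subspace0|rewrite addr0].
move=> a _ _ [y [n [Cy Nn ->]]] [y' [n' [Cy' Nn' ->]]].
exists (a *: y + y'), (a *: n + n'); split; [exact: Zs.2|exact: Cb.2|].
by rewrite scalerDr addrACA.
Qed.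

Let B1M1 b : boundaries C' N b `<=` M1 b.
Proof.
move=> x Bx; split; first exact: boundaries_cycles Bx.
by case: Bx => y [n [Cy Nn ->]]; exists y, n; split=> //; exact: C'C.
Qed.

Let B2M2 b : boundaries C N b `<=` M2 b.
Proof.
move=> _ [y [n [Cy Nn ->]]]; exists n, y; split; rewrite 1?addrC //.
by split; [exact: NC'|apply: (Ns b).2].
Qed.

Let M2Z2 b : M2 b `<=` cycles C N b.
Proof.
move=> _ [z [y [[Cz Nz] Cy ->]]]; split.
  by apply: subspaceD; [exact: (Cs b).1|exact: C'C|exact: dC].
by rewrite dD dd addr0.
Qed.

Let B3M3 b : boundaries C C' b `<=` M3 b.
Proof.
move=> _ [y [n [Cy Nn ->]]]; exists (d y), n; split=> //.
by split; [exact: dC|rewrite dd; exact: subspace0 (Ns _).1].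
Qed.

Let M3Z3 b : M3 b `<=` cycles C C' b.
Proof.
move=> _ [z [y [[Cz Nz] Cy ->]]]; split.
  by apply: subspaceD; [exact: (Cs b).1| |exact: C'C].
rewrite dD; apply: subspaceD; first exact: (C's _).1.
  exact: NC'.
exact: (C's b).2.
Qed.

(** [iso1], [iso2] and [iso3] express exactness of the hexagon: each group modulo the incoming image
    is isomorphic to the outgoing image. The third map is the connecting one, induced by [d], whence
    the change of parity. *)
Let iso1 b n : quot_dim (cycles C' N b) (M1 b) n <->
               quot_dim (M2 b) (boundaries C N b) n.
Proof.
apply: (quot_dim_iso (phi := id)) => //.
- exact: cycles_subspace.
- exact: boundaries_subspace.
- move=> z Zz; exists z, 0; split=> //; last by rewrite d0 addr0.
  exact: subspace0 (Cs _).1.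
- move=> _ [z [y [Zz Cy ->]]]; exists z; split=> //.
  exists y, 0; split=> //; first exact: subspace0 (Ns _).1.
  by rewrite addr0 addrC addKr.
- by move=> z Zz; split=> [Bz|[]].
Qed.

Let iso2 b n : quot_dim (cycles C N b) (M2 b) n <->
               quot_dim (M3 b) (boundaries C C' b) n.
Proof.
apply: (quot_dim_iso (phi := id)) => //.
- exact: cycles_subspace.
- exact: boundaries_subspace.
- move=> z Zz; exists z, 0; split=> //; last by rewrite addr0.
  exact: subspace0 (C's _).1.
- move=> _ [z [y [Zz Cy ->]]]; exists z; split=> //.
  exists 0, y; split=> //; first exact: subspace0 (Cs _).1.
  by rewrite d0 add0r addrC addKr.
- move=> z [Cz Nz]; split=> [[y [n' [Cy Cn zE]]]|[z' [y [[Cz' _] Cy ->]]]].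
    exists n', y; split=> //; last by rewrite addrC.
    split=> //; suff -> : d n' = d z by [].
    by rewrite zE dD dd add0r.
  by exists y, z'; split=> //; rewrite addrC.
Qed.

Let iso3 b n : quot_dim (cycles C C' b) (M3 b) n <->
               quot_dim (M1 (~~ b)) (boundaries C' N (~~ b)) n.
Proof.
apply: (quot_dim_iso (phi := d)) => //.
- exact: cycles_subspace.
- exact: boundaries_subspace.
- move=> z [Cz C'z]; split.
    by split=> //; rewrite dd; exact: subspace0 (Ns _).1.
  exists z, 0; rewrite negbK addr0; split=> //; exact: subspace0 (Ns _).1.
- move=> w [[Cz Nz] [y [n' [Cy Nn' wE]]]]; rewrite negbK in Cy.
  exists y; split.
    split=> //; have -> : d y = (d y + n') - n' by rewrite addrK.
    rewrite -wE; apply: subspaceB => //; first exact: (C's _).1.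
    exact: NC'.
  exists 0, n'; split=> //; first exact: subspace0 (C's _).1.
  by rewrite wE d0 add0r addrC addKr.
- move=> z [Cz C'z]; split=> [[y [n' [Cy Nn' zE]]]|[x [y [[Cx Nx] Cy ->]]]].
    rewrite negbK in Cy; exists (z - y), y; split=> //; last by rewrite subrK.
    split; first by apply: subspaceB; [exact: (Cs _).1| |exact: C'C].
    by rewrite dB zE addrC addKr.
  by exists y, (d x); rewrite negbK; split=> //; rewrite dD addrC.
Qed.

(** Each dimension is the sum of the ranks of two consecutive maps of the hexagon. The rank of the
    connecting map occurs in H(C'/N) and H(C/C') with opposite signs and cancels. *)
Lemma complex_chi_triple_mid a c :
  complex_chi C' N a -> complex_chi C C' c -> complex_chi C N (a + c).
Proof.
move=> [h [Hh ->]] [h' [Hh' ->]].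
have split1 b := quot_dim_split (M1s b) (boundaries_subspace b C's Ns)
  (@B1M1 b) (@subIsetl _ _ _) (Hh b).
have split3 b := quot_dim_split (M3s b) (boundaries_subspace b Cs C's)
  (@B3M3 b) (@M3Z3 b) (Hh' b).
have [m1 Hm1] := choice split1; have [p1 Hp1] := choice Hm1.
have [m3 Hm3] := choice split3; have [p3 Hp3] := choice Hm3.
have H2 b : quot_dim (cycles C N b) (boundaries C N b) (p1 b + m3 b).
  apply: (quot_dim_add (M2s b) (boundaries_subspace b Cs Ns) (@B2M2 b) (@M2Z2 b)).
    by rewrite -iso1; case: (Hp1 b).
  by rewrite iso2; case: (Hp3 b).
exists (fun b => (p1 b + m3 b)%N); split=> //.
have E b : m1 (~~ b) = p3 b.
  apply: (quot_dim_uniq (boundaries_subspace (~~ b) C's Ns)).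
    by case: (Hp1 (~~ b)) => H _ _; exact: H.
  by rewrite -iso3; case: (Hp3 b).
have [_ _ ->] := Hp1 true; have [_ _ ->] := Hp1 false.
have [_ _ ->] := Hp3 true; have [_ _ ->] := Hp3 false.
by rewrite -(E true) -(E false) /=; lia.
Qed.

Lemma complex_chi_triple_sub x c :
  complex_chi C N x -> complex_chi C C' c -> complex_chi C' N (x - c).
Proof.
move=> [h [Hh ->]] [h' [Hh' ->]].
have split2 b := quot_dim_split (M2s b) (boundaries_subspace b Cs Ns)
  (@B2M2 b) (@M2Z2 b) (Hh b).
have split3 b := quot_dim_split (M3s b) (boundaries_subspace b Cs C's)
  (@B3M3 b) (@M3Z3 b) (Hh' b).
have [m2 Hm2] := choice split2; have [p2 Hp2] := choice Hm2.
have [m3 Hm3] := choice split3; have [p3 Hp3] := choice Hm3.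
have H1 b : quot_dim (cycles C' N b) (boundaries C' N b) (p3 (~~ b) + m2 b).
  apply: (quot_dim_add (M1s b) (boundaries_subspace b C's Ns) (@B1M1 b)).
  - exact: subIsetl.
  - by rewrite -[b in M1 b]negbK -[b in boundaries _ _ b]negbK -iso3;
    case: (Hp3 (~~ b)).
  - by rewrite iso1; case: (Hp2 b).
exists (fun b => (p3 (~~ b) + m2 b)%N); split=> //.
have E b : m3 b = p2 b.
  apply: (quot_dim_uniq (boundaries_subspace b Cs C's)).
    by case: (Hp3 b) => H _ _; exact: H.
  by rewrite -iso2; case: (Hp2 b).
have [_ _ ->] := Hp2 true; have [_ _ ->] := Hp2 false.
have [_ _ ->] := Hp3 true; have [_ _ ->] := Hp3 false.
by rewrite -(E true) -(E false) /=; lia.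
Qed.

End Triple.

(** The hypotheses make the inclusion induce an isomorphism from C1/N1 to C2/N2 already on
    cochains. *)
Lemma complex_chi_change (C1 N1 C2 N2 : bool -> set V) c :
  subcomplex C1 -> subcomplex N1 -> subcomplex C2 -> subcomplex N2 ->
  (forall b, C1 b `<=` C2 b) -> (forall b, N1 b `<=` N2 b) ->
  (forall b, C1 b `&` N2 b `<=` N1 b) ->
  (forall b x, C2 b x -> exists y, C1 b y /\ N2 b (x - y)) ->
  complex_chi C1 N1 c <-> complex_chi C2 N2 c.
Proof.
move=> C1s N1s C2s N2s C12 N12 CN split12.
suff E b n : cohomology_dim C1 N1 b n <-> cohomology_dim C2 N2 b n.
  by split=> -[h [Hh ->]]; exists h; split=> // b; apply/E.
apply: (quot_dim_iso (phi := id)) => //.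
- exact: cycles_subspace.
- exact: boundaries_subspace.
- by move=> z [Cz Nz]; split; [exact: C12|exact: N12].
- move=> w [Cw Nw]; have [y [Cy Ny]] := split12 b w Cw; exists y; split.
    split=> //; apply: CN; split; first exact: (C1s b).2.
    have -> : d y = d w - d (w - y) by rewrite dB subKr.
    by apply: subspaceB => //; [exact: (N2s _).1|exact: (N2s b).2].
  exists 0, (w - y); split=> //; first exact: subspace0 (C2s _).1.
  by rewrite d0 add0r.
- move=> z [Cz Nz]; split=> [[y [n' [Cy Nn' zE]]]|[y [n' [Cy Nn' ->]]]].
    have [y1 [Cy1 Ny1]] := split12 _ y Cy.
    exists y1, (z - d y1); split=> //; last by rewrite addrC subrK.
    apply: CN; split.
      apply: subspaceB => //; first exact: (C1s _).1.
      by have := (C1s _).2 _ Cy1; rewrite negbK.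
    have -> : z - d y1 = d (y - y1) + n' by rewrite zE dB addrAC.
    apply: subspaceD => //; first exact: (N2s _).1.
    by have := (N2s _).2 _ Ny1; rewrite negbK.
  by exists y, n'; split=> //; [exact: C12|exact: N12].
Qed.

End EulerCharOfComplexes.

(** * Alexander-Spanier cochains *)

(** It is defined by recursion because [T] carries no decidable equality, hence no membership in
    sequences. *)
Fixpoint inside (T : Type) (A : set T) (s : seq T) : Prop :=
  if s is x :: s' then A x /\ inside A s' else True.

Lemma cochain_linE (U : Type) (c : rat) (f g : seq U -> rat^o) s :
  (c *: f + g) s = c * f s + g s.
Proof. by []. Qed.

Section CochainAlgebra.
Variables S T : Type.
Implicit Types (f g : seq T -> rat^o) (s : seq T).

Fixpoint coboundary_rec s f : rat^o :=
  if s is x :: s' then f s' - coboundary_rec s' (fun u => f (x :: u)) else 0.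

(* The nested subtractions produce the signs of the alternating sum over faces. *)
Definition coboundary f : seq T -> rat^o := fun s => coboundary_rec s f.

Definition restrict_support (A : set T) f : seq T -> rat^o :=
  fun s => if `[< inside A s >] then f s else 0.

Definition pullback (a : S -> T) f : seq S -> rat^o := fun s : seq S => f (map a s).

(** Unfolded, this is the alternating sum over i of f(a x_0, ..., a x_i, b x_i, ..., b x_n), the
    simplicial prism operator. *)
Fixpoint prism_rec (a b : S -> T) (s : seq S) f : rat^o :=
  if s is x :: s' then
    f (a x :: b x :: map b s') - prism_rec a b s' (fun u => f (a x :: u))
  else 0.

Definition prism (a b : S -> T) f : seq S -> rat^o :=
  fun s : seq S => prism_rec a b s f.

Lemma coboundary_cons f x s :
  coboundary f (x :: s) = f s - coboundary (fun u => f (x :: u)) s.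
Proof. by []. Qed.

Lemma prism_cons a b f x (s : seq S) : prism a b f (x :: s) =
  f (a x :: b x :: map b s) - prism a b (fun u => f (a x :: u)) s.
Proof. by []. Qed.

Lemma coboundary_lin (c : rat) f g :
  coboundary (c *: f + g) = c *: coboundary f + coboundary g.
Proof.
apply/funext => s; rewrite cochain_linE.
elim: s f g => [|x s IHs] f g; first by rewrite mulr0 addr0.
rewrite !coboundary_cons cochain_linE.
have -> : coboundary (fun u => (c *: f + g) (x :: u)) s =
    c * coboundary (fun u => f (x :: u)) s + coboundary (fun u => g (x :: u)) s.
  by rewrite -IHs.
by rewrite opprD mulrBr addrACA.
Qed.

Lemma coboundaryB f g s :
  coboundary (fun u => f u - g u) s = coboundary f s - coboundary g s.
Proof.
have /(congr1 (@^~ s)) /= := coboundary_lin (-1) g f.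
rewrite cochain_linE mulN1r => E; rewrite [RHS]addrC -E.
by congr (coboundary _ s); apply/funext => u; rewrite cochain_linE mulN1r addrC.
Qed.

Lemma coboundaryK f : coboundary (coboundary f) = 0.
Proof.
apply/funext => s; elim: s f => [//|x s IHs] f; rewrite coboundary_cons.
have -> : (fun u => coboundary f (x :: u)) =
    (fun u => f u - coboundary (fun v => f (x :: v)) u) by [].
by rewrite coboundaryB opprB addrCA subrr addr0 IHs.
Qed.

Lemma prism_lin a b (c : rat) f g :
  prism a b (c *: f + g) = c *: prism a b f + prism a b g.
Proof.
apply/funext => s; rewrite cochain_linE.
elim: s f g => [|x s IHs] f g; first by rewrite mulr0 addr0.
rewrite !prism_cons cochain_linE.
have -> : prism a b (fun u => (c *: f + g) (a x :: u)) s =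
    c * prism a b (fun u => f (a x :: u)) s + prism a b (fun u => g (a x :: u)) s.
  by rewrite -IHs.
by rewrite opprD mulrBr addrACA.
Qed.

Lemma prismB a b f g (s : seq S) :
  prism a b (fun u => f u - g u) s = prism a b f s - prism a b g s.
Proof.
have /(congr1 (@^~ s)) /= := prism_lin a b (-1) g f.
rewrite cochain_linE mulN1r => E; rewrite [RHS]addrC -E.
by congr (prism _ _ _ s); apply/funext => u; rewrite cochain_linE mulN1r addrC.
Qed.

Lemma sub_inside (A B : set T) s : A `<=` B -> inside A s -> inside B s.
Proof.
by move=> AB; elim: s => [//|x s IHs] /= [Ax /IHs Bs]; split=> //; exact: AB.
Qed.

Lemma inside_map (A : set S) (B : set T) a (s : seq S) :
  (forall x, A x -> B (a x)) -> inside A s -> inside B (map a s).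
Proof.
by move=> AB; elim: s => [//|x s IHs] /= [Ax /IHs Bs]; split=> //; exact: AB.
Qed.

Lemma coboundary_eq0 (A : set T) f : (forall s, inside A s -> f s = 0) ->
  forall s, inside A s -> coboundary f s = 0.
Proof.
move=> f0 s; elim: s f f0 => [//|x s IHs] f f0 [Ax As].
rewrite coboundary_cons f0 // IHs ?subrr // => u Au.
exact: f0.
Qed.

Lemma prism_eq0 (A : set S) (B : set T) a b f :
  (forall x, A x -> B (a x)) -> (forall x, A x -> B (b x)) ->
  (forall s, inside B s -> f s = 0) ->
  forall s : seq S, inside A s -> prism a b f s = 0.
Proof.
move=> Aa Ab f0 s; elim: s f f0 => [//|x s IHs] f f0 [Ax As].
rewrite prism_cons f0 ?sub0r; last first.
  by split; [exact: Aa|split; [exact: Ab|exact: inside_map As]].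
rewrite IHs ?oppr0 // => u Bu; apply: f0.
by split=> //; exact: Aa.
Qed.

Lemma coboundary_parity b f : (forall s, odd (size s) != b -> f s = 0) ->
  forall s, odd (size s) != ~~ b -> coboundary f s = 0.
Proof.
move=> f0 s; elim: s b f f0 => [//|x s IHs] b f f0; rewrite [size _]/= oddS => sb.
rewrite coboundary_cons f0; last by case: (odd _) sb; case: (b).
rewrite (IHs (~~ b)) ?subrr //.
- by move=> u ub; apply: f0 => /=; move: ub; case: (odd _); case: (b).
- by move: sb; case: (odd _); case: (b).
Qed.

Lemma prism_parity a b c f : (forall s, odd (size s) != c -> f s = 0) ->
  forall s : seq S, odd (size s) != ~~ c -> prism a b f s = 0.
Proof.
move=> f0 s; elim: s c f f0 => [//|x s IHs] c f f0; rewrite [size _]/= oddS => sb.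
rewrite prism_cons f0; last by rewrite /= size_map; case: (odd _) sb; case: (c).
rewrite (IHs (~~ c)) ?subrr //.
- by move=> u ub; apply: f0 => /=; move: ub; case: (odd _); case: (c).
- by move: sb; case: (odd _); case: (c).
Qed.

Lemma restrict_support_in A f s : inside A s -> restrict_support A f s = f s.
Proof. by move=> As; rewrite /restrict_support asboolT. Qed.

Lemma restrict_support_eq0 A f s : f s = 0 -> restrict_support A f s = 0.
Proof. by move=> f0; rewrite /restrict_support f0 if_same. Qed.

(** The empty sequence lies inside every set, disjoint or not, hence the hypothesis on [f [::]]. *)
Lemma restrict_support_disjoint A B f s : A `&` B = set0 ->
  f [::] = 0 -> inside B s -> restrict_support A f s = 0.
Proof.
move=> AB f0; case: s => [_|x s [Bx _]].
  exact: restrict_support_eq0.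
rewrite /restrict_support asboolF // => -[Ax _].
by have : (A `&` B) x by []; rewrite AB.
Qed.

End CochainAlgebra.

Lemma coboundary_pullback (S T : Type) (a : S -> T) (f : seq T -> rat^o) :
  coboundary (pullback a f) = pullback a (coboundary f).
Proof.
apply/funext => s; elim: s f => [//|x s IHs] f.
by rewrite coboundary_cons -[fun u => _]/(pullback a (fun u => f (a x :: u))) IHs.
Qed.

(** Unfolded at [x :: s], the two summands contain the coboundary of [h] with opposite signs. What
    remains is the induction hypothesis for [fx], which is [f] with the first vertex fixed at
    [a x]. *)
Lemma prism_homotopy (S T : Type) (a b : S -> T) (f : seq T -> rat^o) s :
  coboundary (prism a b f) s + prism a b (coboundary f) s =
  pullback b f s - pullback a f s.
Proof.
elim: s f => [|x s IHs] f; first exact/esym/(subrr (f [::])).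
pose fx := fun u => f (a x :: u); pose h := fun u => pullback b fx (x :: u).
have -> : coboundary (prism a b f) (x :: s) =
    prism a b f s - (coboundary h s - coboundary (prism a b fx) s).
  by rewrite -coboundaryB.
have -> : prism a b (coboundary f) (x :: s) =
    (f (b x :: map b s) - coboundary fx (b x :: map b s))
    - (prism a b f s - prism a b (coboundary fx) s).
  by rewrite -prismB.
have -> : coboundary fx (b x :: map b s) =
    pullback b fx s - coboundary h s.
  by rewrite -coboundary_cons coboundary_pullback.
have := IHs fx; rewrite {3}/pullback /fx /= -/fx {2 3}/pullback /= => IH.
have -> : coboundary (prism a b fx) s = pullback b fx s - f (a x :: map a s)
    - prism a b (coboundary fx) s by rewrite -IH addrK.
have ringid (u v w p q r : rat) :
  u - (w - (p - r - v)) + (q - (p - w) - (u - v)) = q - r by ring.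
exact: ringid.
Qed.

Section AlexanderSpanier.
Variable T : topologicalType.
Implicit Types (X A K : set T) (f g : seq T -> rat^o).

(** Cochains live on the whole ambient space. A subset [X] enters only here and in the choice of
    compact supports, so cochains of different subsets can be compared directly. *)
Definition locally_zero X f (x : T) : Prop :=
  exists2 U, nbhs x U & forall s, inside (U `&` X) s -> f s = 0.

(* Simplices are nonempty sequences, so cochains vanish at [[::]]. *)
Definition graded_cochain (b : bool) f : Prop :=
  f [::] = 0 /\ forall s, odd (size s) != b -> f s = 0.

Definition compactly_supported X f : Prop :=
  exists K, [/\ compact K, K `<=` X & forall x, X x -> ~ K x -> locally_zero X f x].

Definition cc_cochains X b : set (seq T -> rat^o) :=
  [set f | graded_cochain b f /\ compactly_supported X f].

Definition null_cochains X b : set (seq T -> rat^o) :=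
  [set f | graded_cochain b f /\ forall x, X x -> locally_zero X f x].

(* [X] has finite-dimensional Alexander-Spanier cohomology with compact supports
   and rational coefficients, with alternating sum of dimensions [c]. *)
Definition has_chi X (c : int) : Prop :=
  complex_chi (@coboundary T) (cc_cochains X) (null_cochains X) c.

Lemma locally_zero_sub X A f x :
  A `<=` X -> locally_zero X f x -> locally_zero A f x.
Proof.
move=> AX [U Ux f0]; exists U => // s As; apply: f0.
by apply: sub_inside As => y [Uy /AX].
Qed.

Lemma locally_zero_lin X (a : rat) f g x :
  locally_zero X f x -> locally_zero X g x -> locally_zero X (a *: f + g) x.
Proof.
move=> [U Ux f0] [W Wx g0]; exists (U `&` W); first exact: filterI.
move=> s Xs; rewrite cochain_linE f0 ?g0 ?mulr0 ?addr0 //.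
- by apply: sub_inside Xs => y [[]].
- by apply: sub_inside Xs => y [[]].
Qed.

Lemma locally_zero0 X x : locally_zero X 0 x.
Proof. by exists setT => //; exact: filterT. Qed.

Lemma locally_zeroB X f g x :
  locally_zero X f x -> locally_zero X g x -> locally_zero X (f - g) x.
Proof.
move=> f0 g0; have -> : f - g = -1 *: g + f by rewrite scaleN1r addrC.
exact: locally_zero_lin.
Qed.

Lemma locally_zeroD X f g x :
  locally_zero X f x -> locally_zero X g x -> locally_zero X (f + g) x.
Proof. by move=> f0 g0; rewrite -[f]scale1r; exact: locally_zero_lin. Qed.

Lemma locally_zero_coboundary X f x :
  locally_zero X f x -> locally_zero X (coboundary f) x.
Proof. by move=> [U Ux f0]; exists U => //; exact: coboundary_eq0. Qed.

Lemma locally_zero_restrict X A f x :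
  locally_zero X f x -> locally_zero X (restrict_support A f) x.
Proof.
by move=> [U Ux f0]; exists U => // s Us; rewrite restrict_support_eq0 ?f0.
Qed.

Lemma locally_zero_outside X K f x : closed K -> ~ K x -> f [::] = 0 ->
  locally_zero X (restrict_support K f) x.
Proof.
move=> cK Kx f0; exists (~` K).
  by apply: open_nbhs_nbhs; split => //; rewrite openC.
move=> s Ks; apply: (@restrict_support_disjoint _ _ (~` K)) => //.
  exact: setICr.
by apply: sub_inside Ks => y [].
Qed.

Lemma locally_zero_restrictB X (C : set T) f x :
  (exists2 U, nbhs x U & U `&` X `<=` C) ->
  locally_zero X (f - restrict_support C f) x.
Proof.
move=> [U Ux UC]; exists U => // s Us.
rewrite -[LHS]/(f s - restrict_support C f s) restrict_support_in ?subrr //.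
exact: sub_inside Us.
Qed.

Lemma graded_lin b (a : rat) f g :
  graded_cochain b f -> graded_cochain b g -> graded_cochain b (a *: f + g).
Proof.
move=> [f0 fb] [g0 gb]; split; first by rewrite cochain_linE f0 g0 mulr0 addr0.
by move=> s sb; rewrite cochain_linE fb // gb // mulr0 addr0.
Qed.

Lemma graded0 b : graded_cochain b 0. Proof. by []. Qed.

Lemma gradedB b f g :
  graded_cochain b f -> graded_cochain b g -> graded_cochain b (f - g).
Proof.
move=> fb gb; have -> : f - g = -1 *: g + f by rewrite scaleN1r addrC.
exact: graded_lin.
Qed.

Lemma graded_coboundary b f :
  graded_cochain b f -> graded_cochain (~~ b) (coboundary f).
Proof. by move=> [f0 fb]; split=> // s sb; rewrite (coboundary_parity fb). Qed.

Lemma graded_prism (a c : T -> T) b f :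
  graded_cochain b f -> graded_cochain (~~ b) (prism a c f).
Proof. by move=> [f0 fb]; split=> // s sb; rewrite (prism_parity _ _ fb). Qed.

Lemma graded_restrict A b f :
  graded_cochain b f -> graded_cochain b (restrict_support A f).
Proof.
move=> [f0 fb]; split; first exact: restrict_support_eq0.
by move=> s sb; rewrite restrict_support_eq0 ?fb.
Qed.

Lemma compactly_supported_lin X (a : rat) f g : compactly_supported X f ->
  compactly_supported X g -> compactly_supported X (a *: f + g).
Proof.
move=> [K [cK KX f0]] [L [cL LX g0]]; exists (K `|` L); split.
- exact: compactU.
- by rewrite subUset.
- move=> x Xx /not_orP[Kx Lx]; apply: locally_zero_lin; [exact: f0|exact: g0].
Qed.

Lemma compactly_supported0 X : compactly_supported X 0.
Proof.
by exists set0; split=> // [|x _ _]; [exact: compact0|exact: locally_zero0].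
Qed.

Lemma compactly_supportedB X f g : compactly_supported X f ->
  compactly_supported X g -> compactly_supported X (f - g).
Proof.
move=> fb gb; have -> : f - g = -1 *: g + f by rewrite scaleN1r addrC.
exact: compactly_supported_lin.
Qed.

Lemma compactly_supported_coboundary X f :
  compactly_supported X f -> compactly_supported X (coboundary f).
Proof.
move=> [K [cK KX f0]]; exists K; split=> // x Xx Kx.
exact/locally_zero_coboundary/f0.
Qed.

Lemma compactly_supported_null X f :
  (forall x, X x -> locally_zero X f x) -> compactly_supported X f.
Proof. by move=> f0; exists set0; split=> //; [exact: compact0|move=> x Xx _;
  exact: f0]. Qed.

Lemma subcomplex_of (P : (seq T -> rat^o) -> Prop) :
  P 0 -> (forall (a : rat) f g, P f -> P g -> P (a *: f + g)) ->
  (forall f, P f -> P (coboundary f)) ->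
  subcomplex (@coboundary T) (fun b => [set f | graded_cochain b f /\ P f]).
Proof.
move=> P0 Plin Pd b; split; first split.
- by split; [exact: graded0|].
- by move=> a f g [fb Pf] [gb Pg]; split; [exact: graded_lin|exact: Plin].
- by move=> f [fb Pf]; split; [exact: graded_coboundary|exact: Pd].
Qed.

Lemma cc_cochains_subcomplex X : subcomplex (@coboundary T) (cc_cochains X).
Proof.
apply: subcomplex_of.
- exact: compactly_supported0.
- by move=> *; exact: compactly_supported_lin.
- exact: compactly_supported_coboundary.
Qed.

Lemma null_cochains_subcomplex X : subcomplex (@coboundary T) (null_cochains X).
Proof.
apply: subcomplex_of.
- by move=> x _; exact: locally_zero0.
- by move=> a f g f0 g0 x Xx; apply: locally_zero_lin; [exact: f0|exact: g0].
- by move=> f f0 x Xx; exact/locally_zero_coboundary/f0.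
Qed.

Lemma has_chi_uniq X c c' : has_chi X c -> has_chi X c' -> c = c'.
Proof.
apply: complex_chi_uniq; first exact: coboundary_lin.
- exact: cc_cochains_subcomplex.
- exact: null_cochains_subcomplex.
Qed.

Lemma has_chi_acyclic X :
  (forall b f, cc_cochains X b f -> null_cochains X (~~ b) (coboundary f) ->
    exists2 g, cc_cochains X (~~ b) g &
      forall x, X x -> locally_zero X (f - coboundary g) x) ->
  has_chi X 0.
Proof.
move=> acyclic; apply: complex_chi0.
- exact: cc_cochains_subcomplex.
- exact: null_cochains_subcomplex.
move=> b f Cf Nf; have [g Cg fg] := acyclic b f Cf Nf.
exists g, (f - coboundary g); split=> //; last by rewrite addrC subrK.
split=> //; apply: gradedB; first by case: Cf.
by case: Cg => /graded_coboundary; rewrite negbK.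
Qed.

Lemma has_chi_set0 : has_chi set0 0.
Proof.
apply: has_chi_acyclic => b f _ _; exists 0 => //.
by split; [exact: graded0|exact: compactly_supported0].
Qed.

Lemma coboundary0 : coboundary (0 : seq T -> rat^o) = 0.
Proof.
by have := coboundary_lin (-1) (0 : seq T -> rat^o) 0;
  rewrite scaler0 addr0 scaleN1r addNr.
Qed.

Lemma coboundary_nseq f n x : coboundary f (nseq n.+1 x) =
  if odd n then 0 else f (nseq n x).
Proof.
elim: n f => [|n IHn] f; first exact: subr0.
rewrite -[nseq n.+2 x]/(x :: nseq n.+1 x) coboundary_cons IHn oddS.
by case: (odd n); rewrite /= ?subrr ?subr0.
Qed.

Lemma inside_set1 (U : set T) x s :
  inside (U `&` [set x]) s -> s = nseq (size s) x.
Proof. by elim: s => [//|y s IHs] /= [[_ ->] /IHs <-]. Qed.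

Lemma locally_zero_set1 f x : (forall n, f (nseq n x) = 0) ->
  locally_zero [set x] f x.
Proof.
move=> f0; exists setT; first exact: filterT.
by move=> s /inside_set1 ->.
Qed.

(** Modulo null cochains, a cochain on a point is the list of its values on constant sequences, on
    which the coboundary is alternately zero and a shift. Only the value on the single vertex,
    detected by [e], survives. *)
Lemma has_chi_set1 x : has_chi [set x] 1.
Proof.
have inx n : inside [set x] (nseq n x) by elim: n.
have fE f : locally_zero [set x] f x -> forall n, f (nseq n x) = 0.
  move=> [U Ux f0] n; apply: f0; elim: n => //= n IHn; split=> //; split=> //.
  exact: nbhs_singleton Ux.
have cs f : compactly_supported [set x] f.
  by exists [set x]; split=> //; exact: compact_set1.
pose e : seq T -> rat^o := fun s => if size s == 1%N then 1 else 0.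
have eg : graded_cochain true e.
  by split=> // s sb; rewrite /e; case: eqP => // s1; rewrite s1 in sb.
exists (fun b => nat_of_bool b); split=> // -[]; last first.
  exists (fun=> 0); split=> [[]|c _ []|f [[fg _] [_ Nf]]] //.
  exists (fun=> 0); rewrite big_ord0 subr0.
  exists 0, f; split.
  - split; [exact: graded0|exact: cs].
  - split=> // y ->; apply: locally_zero_set1 => n.
    have := fE _ (Nf x erefl) n.+1; rewrite coboundary_nseq.
    have [on _|//] := boolP (odd n).
    by apply: fg.2; rewrite size_nseq on.
  - by rewrite coboundary0 add0r.
exists (fun=> e); split.
- move=> i; split; first by split.
  split; first exact: graded_coboundary.
  move=> y ->; apply: locally_zero_set1 => -[//|n]; rewrite coboundary_nseq.
  by case: ifPn => // en; rewrite /e size_nseq; case: eqP => // n1; rewrite n1 in en.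
- move=> c [g [n [Cg [_ Nn]]]] cE i; rewrite ord1.
  have := congr1 (fun f => f (nseq 1 x)) cE.
  rewrite big_ord1 /=.
  have -> : (c ord0 *: e) [:: x] = c ord0 by rewrite -[LHS]/(c ord0 * 1) mulr1.
  rewrite -[X in _ = X -> _]/(coboundary g [:: x] + n (nseq 1 x)).
  by rewrite (fE _ (Nn x erefl)) (coboundary_nseq g 0) /= Cg.1.1 => ->; rewrite addr0.
- move=> f [[fg _] _]; exists (fun=> f [:: x]); rewrite big_ord1.
  (* On constant sequences of odd length at least 3, the coboundary of [g] equals [f]; the value on
     length 1 is taken care of by the multiple of [e]. *)
  pose g : seq T -> rat^o := fun s => if nilp s then 0 else f (x :: s).
  have gg : graded_cochain false g.
    split=> // s sb; rewrite /g; case: nilP => // _; apply: fg.2 => /=.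
    by move: sb; case: (odd _).
  have fegg : graded_cochain true (f - f [:: x] *: e).
    by apply: gradedB => //; rewrite -[_ *: e]addr0; apply: graded_lin;
      [|exact: graded0].
  exists g, (f - f [:: x] *: e - coboundary g); split;
    last by rewrite [RHS]addrC subrK.
  + by split.
  + split; first by apply: gradedB => //; exact: graded_coboundary gg.
    move=> y ->; apply: locally_zero_set1 => -[|n].
      rewrite -[LHS]/(f [::] - f [:: x] * 0 - 0) fg.1; ring.
    rewrite -[LHS]/(f (nseq n.+1 x) - f [:: x] * e (nseq n.+1 x) - coboundary
      g (nseq n.+1 x)).
    rewrite coboundary_nseq; have [on|en] := boolP (odd n).
      rewrite fg.2; last by rewrite size_nseq /= on.
      rewrite /e size_nseq.
      by case: n on => // n _ /=; rewrite mulr0 !subr0.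
    case: n en => [_|n en]; first by rewrite /e /= mulr1 subr0 subrr.
    by rewrite /e size_nseq /= mulr0 subr0 /g /= subrr.
Qed.

End AlexanderSpanier.

(** * Homeomorphism invariance and local compactness *)

Section SetHomeomorphisms.
Variables S T : topologicalType.
Implicit Types (X : set S) (Y : set T).

(* The restrictions of [f] and [g] are inverse homeomorphisms between the
   subspaces [X] and [Y]; outside of these, [f] and [g] are arbitrary. *)
Definition set_homeo X Y (f : S -> T) (g : T -> S) : Prop :=
  [/\ forall x, X x -> Y (f x), forall y, Y y -> X (g y),
      forall x, X x -> g (f x) = x, forall y, Y y -> f (g y) = y &
      {within X, continuous f} /\ {within Y, continuous g}].

Lemma locally_zero_pullback X Y (f : S -> T) (c : seq T -> rat^o) x :
  (forall x, X x -> Y (f x)) -> {within X, continuous f} -> X x ->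
  locally_zero Y c (f x) -> locally_zero X (pullback f c) x.
Proof.
move=> XY /subspace_continuousP cf Xx [U Ufx c0].
exists [set z | X z -> U (f z)]; first exact: cf Xx _ Ufx.
move=> s Xs; apply: c0; apply: inside_map Xs => z [XU Xz].
by split; [exact: XU|exact: XY].
Qed.

Lemma graded_pullback (f : S -> T) b c :
  graded_cochain b c -> graded_cochain b (pullback f c).
Proof. by move=> [c0 cb]; split=> // s sb; rewrite /pullback cb ?size_map. Qed.

End SetHomeomorphisms.

Lemma set_homeo_sym (S T : topologicalType) (X : set S) (Y : set T) f g :
  set_homeo X Y f g -> set_homeo Y X g f.
Proof. by move=> [XY YX fK gK [cf cg]]; split. Qed.

Section HomeoInvariance.
Variables S T : topologicalType.
Variables (X : set S) (Y : set T) (f : S -> T) (g : T -> S).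
Hypothesis fg : set_homeo X Y f g.

Lemma null_pullback b c :
  null_cochains Y b c -> null_cochains X b (pullback f c).
Proof.
case: fg => XY _ _ _ [cf _] [cb cY]; split; first exact: graded_pullback.
move=> x Xx; apply: (locally_zero_pullback XY cf Xx); exact/cY/XY.
Qed.

Lemma cc_pullback b c : cc_cochains Y b c -> cc_cochains X b (pullback f c).
Proof.
case: fg => XY YX fK gK [cf cg] [cb [K [cK KY c0]]].
split; first exact: graded_pullback.
exists [set g y | y in K]; split.
- apply: continuous_compact => //; exact: continuous_subspaceW cg.
- by move=> _ [y Ky <-]; exact/YX/KY.
- move=> x Xx gKx; apply: (locally_zero_pullback XY cf Xx); apply: c0;
  first exact: XY.
  by move=> Kfx; apply: gKx; exists (f x) => //; exact: fK.
Qed.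

End HomeoInvariance.

(** As [g \o f] is the identity only on [X], the double pullback agrees with [c] on sequences in
    [X], that is, up to a null cochain. *)
Lemma null_pullbackK (S T : topologicalType) (X : set S) (Y : set T) f g b c :
  set_homeo X Y f g -> graded_cochain b c ->
  null_cochains X b (c - pullback f (pullback g c)).
Proof.
move=> [XY YX fK gK [cf cg]] cb; split.
  by apply: gradedB => //; do 2 apply: graded_pullback.
move=> x Xx; exists setT; first exact: filterT.
move=> s Xs; rewrite -[LHS]/(c s - c (map g (map f s))).
suff -> : map g (map f s) = s by rewrite subrr.
by elim: s Xs => [//|y s IHs] /= [[_ Xy] /IHs ->]; rewrite fK.
Qed.

Lemma has_chi_homeo (S T : topologicalType) (X : set S) (Y : set T) f g c :
  set_homeo X Y f g -> has_chi X c -> has_chi Y c.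
Proof.
move=> fg [h [Hh ->]]; exists h; split=> // b; move: (Hh b).
have gf := set_homeo_sym fg.
have CX := cc_cochains_subcomplex X; have NX := null_cochains_subcomplex X.
have CY := cc_cochains_subcomplex Y; have NY := null_cochains_subcomplex Y.
have pB (Z W : topologicalType) (a : Z -> W) (u v : seq W -> rat^o) :
  pullback a (u - v) = pullback a u - pullback a v by [].
rewrite /cohomology_dim.
move=> H; rewrite -(quot_dim_iso (Z1 := cycles (@coboundary S) (cc_cochains
  X) (null_cochains X) b)
  (B1 := boundaries (@coboundary S) (cc_cochains X) (null_cochains X) b)
  (phi := pullback g)) //.
- by apply: cycles_subspace => //; exact: coboundary_lin.
- by apply: boundaries_subspace => //; exact: coboundary_lin.
- move=> z [Cz Nz]; split; first exact: cc_pullback gf _ _ Cz.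
  rewrite coboundary_pullback; exact: null_pullback gf _ _ Nz.
- move=> w [Cw Nw]; exists (pullback f w); split.
    split; first exact: cc_pullback fg _ _ Cw.
    by rewrite coboundary_pullback; exact: null_pullback fg _ _ Nw.
  exists 0, (w - pullback g (pullback f w)); split.
  + exact: subspace0 (CY _).1.
  + by apply: null_pullbackK gf _; case: Cw.
  + by rewrite coboundary0 add0r.
- move=> z [Cz Nz]; split=> [[y [n [Cy Nn zE]]]|[y [n [Cy Nn ->]]]]; last first.
    exists (pullback g y), (pullback g n); split.
    + exact: cc_pullback gf _ _ Cy.
    + exact: null_pullback gf _ _ Nn.
    + by rewrite coboundary_pullback.
  exists (pullback f y), (pullback f n + (z - pullback f (pullback g z))); split.
  + exact: cc_pullback fg _ _ Cy.
  + apply: subspaceD; first exact: (NX _).1.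
      exact: null_pullback fg _ _ Nn.
    by apply: null_pullbackK fg _; case: Cz.
  + rewrite zE coboundary_pullback.
    rewrite -[pullback f (_ + n)]/(pullback f (coboundary y) + pullback f n).
    by rewrite addrA addrC subrK.
Qed.

Section LocalCompactness.
Variable T : topologicalType.
Implicit Types X A K : set T.

Definition locally_compact_at X (x : T) : Prop :=
  exists C U, [/\ compact C, C `<=` X, nbhs x U & U `&` X `<=` C].

Definition locally_compact_set X : Prop := forall x, X x -> locally_compact_at X x.

(** This supplies cutoffs: if a cochain is supported in [K], restricting it to sequences in [C]
    changes it by a null cochain only. *)
Lemma locally_compact_nbhs X K : locally_compact_set X -> compact K -> K `<=` X ->
  exists C, [/\ compact C, C `<=` X &
    forall x, K x -> exists2 U, nbhs x U & U `&` X `<=` C].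
Proof.
move=> lX cK KX.
(* Compactness applied to the filter of large compact subsets of [X]. *)
pose F : set_system (set T) := [set P | exists C, [/\ compact C, C `<=` X &
  forall D, compact D -> D `<=` X -> C `<=` D -> P D]].
have FF : Filter F.
  split.
  - by exists set0; split=> //; exact: compact0.
  - move=> P Q [C [cC CX PC]] [D [cD DX QD]]; exists (C `|` D); split.
    + exact: compactU.
    + by rewrite subUset.
    + move=> H cH HX; rewrite subUset => -[CH DH].
      by split; [exact: PC|exact: QD].
  - by move=> P Q PQ [C [cC CX PC]]; exists C; split=> // D cD DX CD; exact/PQ/PC.
have /compact_near_coveringP/(_ _ F
  (fun C x => exists2 U, nbhs x U & U `&` X `<=` C) FF) := cK.
case=> [x /KX/lX[C [U [cC CX Ux UC]]]|C [cC CX KC]].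
  exists (U°, [set D | C `<=` D]).
    by split; [exact: nbhs_interior|exists C].
  move=> [y D] [/= Uy CD]; exists U => //.
  exact: subset_trans CD.
by exists C; split=> //; exact: KC.
Qed.

Lemma locally_compact_closed X A : locally_compact_set X -> A `<=` X ->
  (forall x, X x -> closure A x -> A x) -> locally_compact_set A.
Proof.
move=> lX AX cA a Aa; have [C [U [cC CX Ua UC]]] := lX a (AX a Aa).
exists (C `&` closure A), U; split=> //.
- by apply: compact_closedI => //; exact: closed_closure.
- by move=> x [/CX Xx]; exact: cA.
- by move=> x [Ux Ax]; split; [apply: UC; split=> //;
  exact: AX|exact: subset_closure].
Qed.

Lemma locally_compact_open X O : regular_space T -> locally_compact_set X ->
  O `<=` X -> (forall x, O x -> exists2 U, nbhs x U & U `&` X `<=` O) ->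
  locally_compact_set O.
Proof.
move=> regT lX OX oO x Ox; have [C [U [cC CX Ux UC]]] := lX x (OX x Ox).
have [V Vx VO] := oO x Ox; have [W Wx WV] := regT x V Vx.
exists (C `&` closure W), (U `&` W); split.
- by apply: compact_closedI => //; exact: closed_closure.
- by move=> y [Cy /WV Vy]; apply: VO; split=> //; exact: CX.
- exact: filterI.
- move=> y [[Uy Wy] Oy]; split; last exact: subset_closure.
  by apply: UC; split=> //; exact: OX.
Qed.

End LocalCompactness.

Lemma locally_compact_at_homeo (S T : topologicalType) (X : set S) (Y : set T)
    f g x : set_homeo X Y f g -> X x ->
  locally_compact_at X x -> locally_compact_at Y (f x).
Proof.
move=> [XY YX fK gK [cf /subspace_continuousP cg]] Xx [C [U [cC CX Ux UC]]].
exists [set f x | x in C], [set z | Y z -> U (g z)]; split.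
- by apply: continuous_compact => //; exact: continuous_subspaceW cf.
- by move=> _ [y Cy <-]; exact/XY/CX.
- have Ugfx : nbhs (g (f x)) U by rewrite fK.
  exact: cg (XY x Xx) _ Ugfx.
- move=> z [UY Yz]; exists (g z); last exact: gK.
  by apply: UC; split; [exact: UY|exact: YX].
Qed.

Lemma locally_compact_homeo (S T : topologicalType) (X : set S) (Y : set T) f g :
  set_homeo X Y f g -> locally_compact_set X -> locally_compact_set Y.
Proof.
move=> fg lX y Yy; have [XY YX fK gK _] := fg; rewrite -(gK y Yy).
by apply: locally_compact_at_homeo fg _ _; [|apply: lX]; exact: YX.
Qed.

Lemma set_homeo_restrict (S T : topologicalType) (X X' : set S) (Y Y' : set T)
    f g : set_homeo X Y f g -> X' `<=` X -> Y' `<=` Y ->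
  (forall x, X x -> X' x <-> Y' (f x)) -> set_homeo X' Y' f g.
Proof.
move=> [XY YX fK gK [cf cg]] XX YY E; split.
- by move=> x X'x; apply/E => //; exact: XX.
- by move=> y Y'y; apply/E; [exact/YX/YY|rewrite gK //; exact: YY].
- by move=> x /XX; exact: fK.
- by move=> y /YY; exact: gK.
- by split; [exact: continuous_subspaceW cf|exact: continuous_subspaceW cg].
Qed.

(** * Additivity *)

Lemma not_closureP (T : topologicalType) (A : set T) (x : T) :
  ~ closure A x -> exists2 B, nbhs x B & A `&` B = set0.
Proof.
move=> /existsNP[B /existsNP[Bx /set0P/negP]].
by rewrite negbK => /eqP AB0; exists B.
Qed.

Section Additivity.
Variables (R : realType) (T : normedModType R).
Implicit Types (X A U K : set T) (f g : seq T -> rat^o).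

(* [r] retracts onto [A]; it is discontinuous in general, but continuous within
   [X] at every point of [A]. *)
Lemma nearest_point_retraction X A : A `<=` X ->
  (forall x, X x -> closure A x -> A x) ->
  exists r : T -> T, (forall a, A a -> r a = a) /\
    forall a, A a -> forall M, nbhs a M ->
      exists2 N, nbhs a N & forall x, N x -> X x -> M (r x) /\ A (r x).
Proof.
move=> AX cA.
have [A0|/set0P[a0 Aa0]] := eqVneq A set0.
  by exists id; split=> // a; rewrite A0.
(* The distance to [A] need not be attained, so [r x] only realizes it up to the factor 2. *)
have /choice[r Hr] : forall x, exists y, X x ->
    A y /\ forall a, A a -> `|x - y| <= 2 * `|x - a|.
  move=> x; have [Xx|nXx] := pselect (X x); last by exists x.
  have [Ax|nAx] := pselect (A x).
    by exists x => _; split=> // a _; rewrite subrr normr0 mulr_ge0.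
  pose D : set R := [set `|x - a| | a in A].
  have hD : has_inf D.
    split; first by exists `|x - a0|, a0.
    by exists 0 => _ [a _ <-].
  (* The distance is positive off [A], which is closed in [X], so it can itself serve as the slack
     in the choice of [y]. *)
  have D0 : 0 < inf D.
    have [B Bx AB0] := not_closureP (contra_not (cA x Xx) nAx).
    have [e /= e0 eB] := (nbhs_ballP x B).1 Bx.
    apply: (lt_le_trans e0); apply: lb_le_inf; first by case: hD.
    move=> _ [a Aa <-]; rewrite leNgt; apply/negP => xa.
    have : (A `&` B) a by split=> //; apply: eB; rewrite -ball_normE.
    by rewrite AB0.
  have [_ [y Ay <-] yD] := inf_adherent D0 hD.
  exists y => _; split=> // a Aa; apply: ltW; apply: (lt_le_trans yD).
  suff : inf D <= `|x - a| by lra.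
  by apply: ge_inf; [case: hD|exists a].
have rA a : A a -> r a = a.
  move=> Aa; have [_ /(_ a Aa)] := Hr a (AX a Aa).
  by rewrite subrr normr0 mulr0 normr_le0 subr_eq0 => /eqP.
exists r; split=> // a Aa M /nbhs_ballP[e /= e0 eM].
(* The distance from a to r x is at most |a - x| + |x - r x|, hence at most 3 |a - x|. *)
exists (ball a (e / 3)); first by apply: nbhsx_ballx; rewrite divr_gt0.
move=> x; rewrite -ball_normE /= => xa Xx; have [Arx xr] := Hr x Xx.
split=> //; apply: eM; rewrite -ball_normE /=.
have := xr a Aa; rewrite (distrC x a) => xra.
apply: (le_lt_trans (ler_distD x a (r x))).
move: xa xra; move: (`|a - x|) (`|x - r x|) => u v; lra.
Qed.

Variables X A : set T.
Hypotheses (lX : locally_compact_set X) (AX : A `<=` X).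
Hypothesis cA : forall x, X x -> closure A x -> A x.

Let U := X `\` A.

Let lU : locally_compact_set U.
Proof.
apply: (locally_compact_open _ lX); first exact: uniform_regular.
  by move=> x [].
move=> x [Xx Ax]; have [B Bx AB0] := not_closureP (contra_not (cA Xx) Ax).
  exists B => // y [By Xy]; split=> // Ay.
by have : (A `&` B) y by []; rewrite AB0.
Qed.

(** With [vanish_near_A] this yields a chain null < near A < on A < all compactly supported cochains
    of [X]. Its successive quotients, from the bottom, compute the complement of [A], nothing, and
    [A]. The two conditions differ in the sequences tested near a point of [A]: those within [A], or
    all those within [X]. *)
Let vanish_on_A b := [set f | graded_cochain b f /\
  (compactly_supported X f /\ forall a, A a -> locally_zero A f a)].

Let vanish_near_A b := [set f | graded_cochain b f /\
  (compactly_supported X f /\ forall a, A a -> locally_zero X f a)].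

Let vanish_on_A_sub : subcomplex (@coboundary T) vanish_on_A.
Proof.
apply: subcomplex_of.
- by split=> [|a _]; [exact: compactly_supported0|exact: locally_zero0].
- move=> a f g [cf f0] [cg g0]; split; first exact: compactly_supported_lin.
  by move=> x Ax; apply: locally_zero_lin; [exact: f0|exact: g0].
- move=> f [cf f0]; split; first exact: compactly_supported_coboundary.
  by move=> x Ax; exact/locally_zero_coboundary/f0.
Qed.

Let vanish_near_A_sub : subcomplex (@coboundary T) vanish_near_A.
Proof.
apply: subcomplex_of.
- by split=> [|a _]; [exact: compactly_supported0|exact: locally_zero0].
- move=> a f g [cf f0] [cg g0]; split; first exact: compactly_supported_lin.
  by move=> x Ax; apply: locally_zero_lin; [exact: f0|exact: g0].
- move=> f [cf f0]; split; first exact: compactly_supported_coboundary.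
  by move=> x Ax; exact/locally_zero_coboundary/f0.
Qed.

(** A cochain of [X] is also one of [A], with support cut down to K cap A, which is compact as [A]
    is closed in [X]. Conversely, a cochain of [A] is lifted by the value 0 on sequences not inside
    [A]. *)
Let chi_A n : has_chi A n <->
  complex_chi (@coboundary T) (cc_cochains X) vanish_on_A n.
Proof.
symmetry; apply: complex_chi_change.
- exact: coboundary_lin.
- exact: cc_cochains_subcomplex.
- exact: vanish_on_A_sub.
- exact: cc_cochains_subcomplex.
- exact: null_cochains_subcomplex.
- move=> b f [fb [K [cK KX f0]]]; split=> //.
  exists (K `&` A); split.
  + have -> : K `&` A = K `&` closure A.
      apply/seteqP; split=> x [Kx]; first by split=> //; exact: subset_closure.
      by split=> //; apply: cA => //; exact: KX.
    by apply: compact_closedI => //; exact: closed_closure.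
  + by move=> x [].
  + move=> x Ax /not_andP[Kx|//]; apply: (locally_zero_sub AX).
    by apply: f0 => //; exact: AX.
- by move=> b f [fb [_ f0]].
- by move=> b f [[fb cf] [_ f0]].
- move=> b f [fb [K [cK KA f0]]]; exists (restrict_support A f); split; last first.
    split; first by apply: gradedB => //; exact: graded_restrict.
    move=> a Aa; apply: locally_zero_restrictB; exists setT; first exact: filterT.
    by move=> x [].
  split; first exact: graded_restrict.
  exists K; split=> //; first exact: subset_trans KA AX.
  move=> x Xx Kx; have [Ax|nAx] := pselect (A x).
    have [W Wx fW] := f0 x Ax Kx; exists W => // s Ws.
    rewrite /restrict_support; case: asboolP => // As; apply: fW.
    by elim: s Ws As => [//|y s IHs] /= [[Wy _] /IHs Ws] [Ay /Ws].
  have [B Bx AB0] := not_closureP (contra_not (cA Xx) nAx).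
  exists B => // s Bs.
  apply: (@restrict_support_disjoint _ A B) => //; first by case: fb.
  by apply: sub_inside Bs => y [].
Qed.

(** A cochain with compact support in [U] is lifted to [X] by cutting it off to a compact
    neighbourhood of its support in [U]; the result is locally zero at every point of [A]. *)
Let chi_U n : has_chi U n <->
  complex_chi (@coboundary T) vanish_near_A (null_cochains X) n.
Proof.
have UX : U `<=` X by move=> x [].
symmetry; apply: complex_chi_change.
- exact: coboundary_lin.
- exact: vanish_near_A_sub.
- exact: null_cochains_subcomplex.
- exact: cc_cochains_subcomplex.
- exact: null_cochains_subcomplex.
- move=> b f [fb [[K [cK KX f0]] fA]]; split=> //.
  (* This open set contains [A], so what it leaves of [K] is a compact support inside [U]. *)
  pose O : set T := [set x | locally_zero X f x].
  have oO : open O.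
    rewrite openE => x [W Wx fW]; rewrite /interior.
    apply: filterS (nbhs_interior Wx) => y Wy; exists W => //.
  exists (K `&` ~` O); split.
  + by apply: compact_closedI => //; rewrite closedC.
  + move=> x [Kx Ox]; split; first exact: KX.
    by move=> Ax; exact/Ox/fA.
  + move=> x Ux /not_andP[Kx|/contrapT Ox]; apply: (locally_zero_sub UX) => //.
    by apply: f0 => //; exact: UX.
- by move=> b f [fb f0]; split=> // x [Xx _]; apply: (locally_zero_sub UX); exact: f0.
- move=> b f [[fb [cf fA]] [_ f0]]; split=> // x Xx.
  have [Ax|nAx] := pselect (A x); first exact: fA.
  have [W Wx fW] := f0 x (conj Xx nAx).
  have [B Bx AB0] := not_closureP (contra_not (cA Xx) nAx).
  exists (W `&` B); first exact: filterI.
  move=> s WBs; apply: fW; apply: sub_inside WBs => y [[Wy By] Xy].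
  split=> //; split=> // Ay.
  by have : (A `&` B) y by []; rewrite AB0.
- move=> b f [fb [K [cK KU f0]]].
  have [C [cC CU KC]] := locally_compact_nbhs lU cK KU.
  have clC : closed C by apply: compact_closed cC; exact: norm_hausdorff.
  exists (restrict_support C f); split; last first.
    split; first by apply: gradedB => //; exact: graded_restrict.
    move=> x Ux; have [Kx|nKx] := pselect (K x).
      by apply: locally_zero_restrictB; exact: KC.
    by apply: locally_zeroB; [|apply: locally_zero_restrict]; exact: f0.
  split; first exact: graded_restrict.
  have fC x : ~ C x -> locally_zero X (restrict_support C f) x.
    by move=> nCx; apply: locally_zero_outside => //; case: fb.
  split; first by exists C; split=> // [x /CU[]//|x _]; exact: fC.
  by move=> a Aa; apply: fC => /CU[].
Qed.

(* A cochain vanishing on small simplices of [A] is cohomologous, by the prism on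
   the identity and a retraction onto [A], to one vanishing near [A]. *)
Let near_A_acyclic : complex_chi (@coboundary T) vanish_on_A vanish_near_A 0.
Proof.
apply: complex_chi0 => // b f [fb [[K [cK KX f0]] fA]] [_ [_ dfA]].
have [r [rA rcont]] := nearest_point_retraction AX cA.
have [C [cC CX KC]] := locally_compact_nbhs lX cK KX.
have clC : closed C by apply: compact_closed cC; exact: norm_hausdorff.
(* Off [A] the retraction may be discontinuous, so [g0] need not have compact support and is cut off
   to [C]. By [g0g] the cutoff changes nothing near [A]. *)
pose g0 := prism id r f; pose g := restrict_support C g0.
have g0b : graded_cochain (~~ b) g0 by exact: graded_prism.
have gb : graded_cochain (~~ b) g by exact: graded_restrict.
have gC x : ~ C x -> locally_zero X g x.
  by move=> nCx; apply: locally_zero_outside => //; case: g0b.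
have cg : compactly_supported X g.
  by exists C; split=> // x _; exact: gC.
have prism_near_A h a : A a -> locally_zero X h a ->
    locally_zero X (prism id r h) a.
  move=> Aa [W Wa hW]; have [N Na HN] := rcont a Aa W Wa.
  exists (N `&` W); first exact: filterI.
  apply: (@prism_eq0 _ _ _ (W `&` X)) => // x [[Nx Wx] Xx] //.
  by have [Wr Ar] := HN x Nx Xx; split=> //; exact: AX.
have g0A a : A a -> locally_zero A g0 a.
  move=> /fA[W Wa fW]; exists W => //.
  by apply: (@prism_eq0 _ _ _ (W `&` A)) => // x [Wx Ax] //; rewrite rA.
have g0g a : A a -> locally_zero X (g0 - g) a.
  move=> Aa; have [Ka|nKa] := pselect (K a).
    by apply: locally_zero_restrictB; exact: KC.
  have g0a : locally_zero X g0 a by apply: prism_near_A => //; apply: f0 => //;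
    exact: AX.
  by apply: locally_zeroB => //; exact: locally_zero_restrict.
have rfA a : A a -> locally_zero X (pullback r f) a.
  move=> Aa; have [W Wa fW] := fA a Aa; have [N Na HN] := rcont a Aa W Wa.
  exists N => // s Ns; apply: fW; apply: inside_map Ns => x [Nx Xx].
  exact: HN.
exists (- g), (f + coboundary g); split.
- rewrite -[- g]add0r; split.
    by apply: gradedB; [exact: graded0|].
  split; first by apply: compactly_supportedB => //; exact: compactly_supported0.
  move=> a Aa; apply: locally_zeroB; first exact: locally_zero0.
  exact/locally_zero_restrict/g0A.
- have -> : f + coboundary g = f - coboundary (0 - g).
    congr (_ + _); have := coboundary_lin (-1) g 0.
    by rewrite !addr0 coboundary0 addr0 !scaleN1r sub0r => ->; rewrite opprK.
  split.
    apply: gradedB => //; rewrite -[b]negbK; apply: graded_coboundary.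
    by apply: gradedB => //; exact: graded0.
  split.
    apply: compactly_supportedB; first by exists K.
    apply: compactly_supported_coboundary; apply: compactly_supportedB => //.
    exact: compactly_supported0.
  move=> a Aa.
  (* This is the prism homotopy with the error of the cutoff. Near a point of [A] all three terms
     vanish: the first as [f] vanishes on small sequences of [A] and [r] is continuous there, the
     second as the coboundary of [f] vanishes near [A], the third by [g0g]. *)
  have -> : f - coboundary (0 - g) =
      pullback r f - prism id r (coboundary f) - coboundary (g0 - g).
    apply/funext => s; have := prism_homotopy id r f s; rewrite -/g0.
    have -> : pullback id f s = f s by rewrite /pullback map_id.
    move=> hom.
    have E u v : coboundary (u - v) s = coboundary u s - coboundary v s.
      exact: coboundaryB.
    rewrite -[LHS]/(f s - coboundary (0 - g) s).
    rewrite -[RHS]/(pullback r f s - prism id r (coboundary f) s - coboundary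
      (g0 - g) s).
    rewrite !E coboundary0 -[(0 : seq T -> rat^o) s]/(0 : rat).
    have ringid (p q u v w : rat) : p + q = v - u ->
      u - (0 - w) = v - q - (p - w) by lra.
    exact: ringid hom.
  apply: locally_zeroB; last exact/locally_zero_coboundary/g0g.
  apply: locally_zeroB; first exact: rfA.
  by apply: prism_near_A => //; exact: dfA.
- have -> : coboundary (- g) = - coboundary g.
    by have := coboundary_lin (-1) g 0; rewrite !addr0 coboundary0 addr0 !scaleN1r.
  by rewrite addrC addrK.
Qed.

Let null_near_A b : null_cochains X b `<=` vanish_near_A b.
Proof.
move=> f [fb f0]; split=> //; split; first exact: compactly_supported_null.
by move=> a Aa; apply: f0; exact: AX.
Qed.

Let near_on_A b : vanish_near_A b `<=` vanish_on_A b.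
Proof.
move=> f [fb [cf fA]]; split=> //; split=> // a Aa.
by apply: (locally_zero_sub AX); exact: fA.
Qed.

Let on_A_cc b : vanish_on_A b `<=` cc_cochains X b.
Proof. by move=> f [fb [cf fA]]. Qed.

(** Two triples split the chain: the upper one removes the contribution of [A], the lower one the
    acyclic quotient. *)
Lemma has_chi_setD a x : has_chi A a -> has_chi X x -> has_chi (X `\` A) (x - a).
Proof.
rewrite chi_A chi_U => Aa Xx.
have H := complex_chi_triple_sub (@coboundary_lin T) (@coboundaryK T)
  (cc_cochains_subcomplex X) vanish_on_A_sub (null_cochains_subcomplex X)
  (fun b f Nf => near_on_A (null_near_A Nf)) on_A_cc Xx Aa.
have := complex_chi_triple_sub (@coboundary_lin T) (@coboundaryK T)
  vanish_on_A_sub vanish_near_A_sub (null_cochains_subcomplex X)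
  null_near_A near_on_A H near_A_acyclic.
by rewrite subr0.
Qed.

Lemma has_chi_add a u : has_chi A a -> has_chi (X `\` A) u -> has_chi X (u + a).
Proof.
rewrite chi_A chi_U => Aa Uu.
have := complex_chi_triple_mid (@coboundary_lin T) (@coboundaryK T)
  vanish_on_A_sub vanish_near_A_sub (null_cochains_subcomplex X)
  null_near_A near_on_A Uu near_A_acyclic; rewrite addr0 => H.
exact: (complex_chi_triple_mid (@coboundary_lin T) (@coboundaryK T)
  (cc_cochains_subcomplex X) vanish_on_A_sub (null_cochains_subcomplex X)
  (fun b f Nf => near_on_A (null_near_A Nf)) on_A_cc H Aa).
Qed.

End Additivity.

(** * Products with half-lines and open simplices *)

(** A property inherited by subsets replaces the open cover, so that the lemma applies both to the
    vanishing of cochains and to trivializing sets. *)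
Lemma lebesgue_number (R : realType) (T : pseudoMetricType R) (D : set T)
    (Q : set T -> Prop) : compact D ->
  (forall O O', O' `<=` O -> Q O -> Q O') ->
  (forall x, D x -> exists2 O, nbhs x O & Q O) ->
  exists2 e : R, 0 < e & forall x, D x -> Q (ball x e).
Proof.
move=> cD Qsub QD.
have /compact_near_coveringP/(_ _ (0 : R)^'+ (fun e x => Q (ball x e)) _) := cD.
case=> [x Dx|].
  have [U Ux QU] := QD x Dx; have [e /= e0 eU] := (nbhs_ballP x U).1 Ux.
  exists (ball x (e / 2), [set r | r < e / 2]).
    split; first by apply: nbhsx_ballx; rewrite divr_gt0.
    by apply: nbhs_right_lt; rewrite divr_gt0.
  move=> [y r] /= [xy re]; apply: Qsub QU => z yz.
  apply: eU; apply: (le_ball _ (ball_triangle xy yz)).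
  by move: re; lra.
move=> e /= e0 He; exists (e / 2); first by rewrite divr_gt0.
apply: (He (e / 2)) => //; last by rewrite divr_gt0.
by rewrite /ball_ /= sub0r normrN gtr0_norm ?divr_gt0 //; lra.
Qed.

Section HalfLine.
Variables (R : realType) (T : normedModType R) (Y : set T).
Hypothesis lY : locally_compact_set Y.

Let X : set (R * T) := [set z | 0 <= z.1 /\ Y z.2].

Let push (t : R) (z : R * T) : R * T := (Num.max z.1 t, z.2).

(** Pushing along the half-line moves all points beyond the support of a cocycle, where its pullback
    is zero. A prism between two pushes is harmless only if it sends small sequences to sequences on
    which the coboundary vanishes, so the push proceeds in short steps. *)
Lemma half_line_acyclic : has_chi X 0.
Proof.
apply: has_chi_acyclic => b f [fb [K [cK KX f0]]] [_ df0].
have [M [M0 KM]] : exists M : R, 0 < M /\ forall z, K z -> z.1 < M.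
  have : compact [set z.1 | z in K].
    apply: continuous_compact => //; apply: continuous_subspaceT => z.
    exact: cvg_fst.
  move=> /compact_bounded[B [_ HB]]; exists (`|B| + 2); split.
    by have := normr_ge0 B; lra.
  move=> z Kz; have : `|B| + 1 > B by have := ler_norm B; lra.
  move=> /HB /(_ z.1) H; have : `|z.1| <= `|B| + 1 by apply: H; exists z.
  by have := ler_norm z.1; lra.
have [L [cL LY KL]] : exists C, [/\ compact C, C `<=` Y &
    forall y, (snd @` K) y -> exists2 U, nbhs y U & U `&` Y `<=` C].
  apply: locally_compact_nbhs => //.
    apply: continuous_compact => //; apply: continuous_subspaceT => z.
    exact: cvg_snd.
  by move=> _ [z /KX[_ Yz] <-].
(* A cylinder is used because pushes up to time [M] map it into itself. *)
pose C : set (R * T) := [set z | (0 <= z.1 <= M) /\ L z.2].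
have cC : compact C.
  have -> : C = `[0, M]%classic `*` L.
    by apply/seteqP; split=> z /=; rewrite in_itv.
  by apply: compact_setX => //; exact: segment_compact.
have clC : closed C by apply: compact_closed cC; exact: norm_hausdorff.
have CX : C `<=` X by move=> z [/andP[z0 _] /LY Yz].
have KC z : K z -> exists2 U, nbhs z U & U `&` X `<=` C.
  move=> Kz; have [U Uz UL] : exists2 U, nbhs z.2 U & U `&` Y `<=` L.
    by apply: KL; exists z.
  exists ([set t | t < M] `*` U).
    exists ([set t | t < M], U) => //; split=> //=.
    by apply: lt_nbhsl; exact: KM.
  by move=> w [[/= wM Uw] [w0 Yw]]; split; [rewrite w0 ltW|exact: UL].
(* After the cutoff the cochain vanishes on all sequences beyond [M], not only on small ones; this
   makes the final pullback exactly zero. *)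
pose f' := restrict_support C f.
have fb' : graded_cochain b f' by exact: graded_restrict.
have ff' x : X x -> locally_zero X (f - f') x.
  move=> Xx; have [Kx|nKx] := pselect (K x).
    by apply: locally_zero_restrictB; exact: KC.
  by apply: locally_zeroB; [|apply: locally_zero_restrict]; exact: f0.
have df0' x : X x -> locally_zero X (coboundary f') x.
  move=> Xx; have -> : coboundary f' = coboundary f - coboundary (f - f').
    apply/funext => s.
    rewrite -[RHS]/(coboundary f s - coboundary (f - f') s).
    by rewrite [X in _ - X]coboundaryB subKr.
  by apply: locally_zeroB; [exact: df0|exact/locally_zero_coboundary/ff'].
have [e e0 He] : exists2 e : R, 0 < e & forall x, C x ->
    forall s, inside (ball x e `&` X) s -> coboundary f' s = 0.
  apply: (lebesgue_number (Q := fun U =>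
    forall s, inside (U `&` X) s -> coboundary f' s = 0)) => //.
    by move=> V V' VV H s Vs; apply: H; apply: sub_inside Vs => z [/VV].
  by move=> z /CX; exact: df0'.
have vanish (N : set (R * T)) s : C `&` N = set0 -> inside N s -> f' s = 0.
  by move=> CN; apply: restrict_support_disjoint => //; case: fb.
have vanish_far s : inside [set z | M < z.1] s -> f' s = 0.
  apply: vanish; apply/seteqP; split=> // z [[/andP[_ zM] _] /=].
  by rewrite ltNge zM.
have push_far t z : M < z.1 -> M < (push t z).1.
  by move=> zM; rewrite /= lt_max zM.
(* A point outside the cylinder lies beyond [M] or over a point outside [L]; either region is open
   and preserved by every push. *)
have stable x : X x -> ~ C x -> exists2 N : set (R * T), nbhs x N &
    (forall t z, N z -> N (push t z)) /\ forall s, inside N s -> f' s = 0.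
  move=> [x0 Yx] nCx; have [xM|xM] := ltP M x.1.
    exists [set z | M < z.1]; last by split=> // t z; exact: push_far.
    exists ([set t | M < t], setT) => /=; last by move=> z [].
    by split; [exact: lt_nbhsr|exact: filterT].
  have nLx : ~ L x.2 by move=> Lx; apply: nCx; split=> //; rewrite x0.
  have clL : closed L by apply: compact_closed cL; exact: norm_hausdorff.
  exists [set z | ~ L z.2].
    exists (setT, ~` L); last by move=> z [].
    split; first exact: filterT.
    by apply: open_nbhs_nbhs; split=> //; rewrite openC.
  split=> // s; apply: vanish; apply/seteqP; split=> // z [[_ Lz] /=]; exact.
(* Points within e/2 of [x], pushed to two consecutive times, stay within [e] of the pushed point:
   half of [e] is spent on the ball, half on the time step. *)
pose st (j : nat) : R := j%:R * (e / 2).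
have st0 j : 0 <= st j by rewrite mulr_ge0 // divr_ge0 // ltW.
have pushX j z : X z -> X (push (st j) z).
  by move=> [z0 Yz]; split=> //=; rewrite le_max z0.
have stS j : st j.+1 = st j + e / 2 by rewrite /st -natr1 mulrDl mul1r.
have step j : forall x, X x ->
  locally_zero X (prism (push (st j)) (push (st j.+1)) (coboundary f')) x.
  move=> x Xx; have [Cx|nCx] := pselect (C x); last first.
    have [N Nx [Npush fN]] := stable x Xx nCx; exists N => // s Ns.
    apply: (@prism_eq0 _ _ N N) => //; try by move=> z; exact: Npush.
      exact: coboundary_eq0.
    by apply: sub_inside Ns => z [].
  have stjS : st j <= st j.+1 by rewrite stS; move: e0; lra.
  have [jM|jM] := ltP M (st j).
    exists setT; first exact: filterT.
    apply: (@prism_eq0 _ _ _ [set z | M < z.1]).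
    - by move=> z _ /=; rewrite lt_max jM orbT.
    - by move=> z _ /=; rewrite lt_max (lt_le_trans jM stjS) orbT.
    - exact: coboundary_eq0 vanish_far.
  exists (ball x (e / 2)); first by apply: nbhsx_ballx; rewrite divr_gt0.
  have Cp : C (push (st j) x).
    case: Cx => /andP[x0 xM] Lx; split=> //=.
    by rewrite le_max x0 ge_max xM.
  apply: (@prism_eq0 _ _ _ (ball (push (st j) x) e `&` X)).
  - move=> z [[xz1 xz2] Xz]; split; last exact: pushX.
    split => /=; last by apply: le_ball xz2; lra.
    move: xz1; rewrite -!ball_normE /= !ltr_norml => /andP[h1 h2].
    rewrite !maxEle; case: (leP x.1 (st j)) => h3;
      case: (leP z.1 (st j)) => h4; apply/andP; split; lra.
  - move=> z [[xz1 xz2] Xz]; split; last exact: pushX.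
    split => /=; last by apply: le_ball xz2; lra.
    move: xz1; rewrite -!ball_normE /= !ltr_norml stS => /andP[h1 h2].
    rewrite !maxEle; case: (leP x.1 (st j)) => h3;
      case: (leP z.1 (st j + e / 2)) => h4; apply/andP; split; lra.
  - exact: He.
have prism_cc j : cc_cochains X (~~ b) (prism (push (st j)) (push (st j.+1)) f').
  split; first exact: graded_prism.
  exists C; split=> // x Xx nCx.
  have [N Nx [Npush fN]] := stable x Xx nCx; exists N => // s Ns.
  apply: (@prism_eq0 _ _ N N) => //; try by move=> z; exact: Npush.
  by apply: sub_inside Ns => z [].
have homotopy j : exists2 g, cc_cochains X (~~ b) g & forall x, X x ->
    locally_zero X (f' - pullback (push (st j)) f' - coboundary g) x.
  elim: j => [|j [g Cg Hg]].
    exists 0; first by split; [exact: graded0|exact: compactly_supported0].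
    move=> x Xx; exists setT; first exact: filterT.
    move=> s Xs; rewrite coboundary0.
    rewrite -[LHS]/(f' s - f' (map (push (st 0)) s) - 0) subr0.
    suff -> : map (push (st 0)) s = s by rewrite subrr.
    elim: s Xs => [//|[t y] s IHs] /= [[_ [/= t0 _]] /IHs ->].
    by rewrite /push /st mul0r /= max_l.
  exists (g - prism (push (st j)) (push (st j.+1)) f').
    split; first by apply: gradedB; [case: Cg|case: (prism_cc j)].
    by apply: compactly_supportedB; [case: Cg|case: (prism_cc j)].
  move=> x Xx; set D := prism _ _.
  have -> : f' - pullback (push (st j.+1)) f' - coboundary (g - D f') =
      f' - pullback (push (st j)) f' - coboundary g - D (coboundary f').
    apply/funext => s.
    have hom := prism_homotopy (push (st j)) (push (st j.+1)) f' s.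
    rewrite -[LHS]/(f' s - pullback (push (st j.+1)) f' s - coboundary (g - D f') s).
    rewrite -[RHS]/(f' s - pullback (push (st j)) f' s - coboundary g s - D
      (coboundary f') s).
    rewrite [X in _ - X]coboundaryB.
    have ringid (p q r u v w : rat) : p + q = v - u ->
      r - v - (w - p) = r - u - w - q by lra.
    exact: ringid hom.
  by apply: locally_zeroB; [exact: Hg|exact: step].
have [j jM] : exists j, M < st j.
  have e2 : 0 < e / 2 by rewrite divr_gt0.
  exists (Num.bound (M / (e / 2))).
  rewrite /st -ltr_pdivrMr //; apply: le_lt_trans (archi_boundP _).
    exact: lexx.
  by rewrite divr_ge0 // ltW.
have [g Cg Hg] := homotopy j; exists g => // x Xx.
have F0 : pullback (push (st j)) f' = 0.
  apply/funext => s; apply: vanish_far.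
  by elim: s => //= z s IHs; split=> //; rewrite lt_max jM orbT.
have -> : f - coboundary g = (f - f') +
    (f' - pullback (push (st j)) f' - coboundary g).
  by rewrite F0 subr0 addrA subrK.
by apply: locally_zeroD; [exact: ff'|exact: Hg].
Qed.

End HalfLine.

Lemma cvg_matrix (R : realType) (S : Type) (F : set_system S) (m n : nat)
    (f : S -> 'M[R]_(m, n)) (M : 'M[R]_(m, n)) : Filter F ->
  (forall i j, f x i j @[x --> F] --> M i j) -> f x @[x --> F] --> M.
Proof.
move=> FF fM A [P /= MP PA].
have : F [set x | forall ij : 'I_m * 'I_n, P ij.1 ij.2 (f x ij.1 ij.2)].
  by apply: filter_forall => -[i j]; exact: fM (MP i j).
move=> H; apply: (@filterS _ F FF _ _ _ H) => x Px.
by apply: PA => i j; exact: (Px (i, j)).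
Qed.

Lemma continuous_at_matrix (R : realType) (S : topologicalType) (m n : nat)
    (f : S -> 'M[R]_(m, n)) (x : S) :
  (forall i j, {for x, continuous (fun z => f z i j)}) -> {for x, continuous f}.
Proof. by move=> fx; apply: cvg_matrix => i j; exact: fx. Qed.

Lemma eq_continuous_at (S T : topologicalType) (f g : S -> T) (x : S) :
  f =1 g -> {for x, continuous f} -> {for x, continuous g}.
Proof. by move=> /funext ->. Qed.

Lemma continuous_at_pair (S T U : topologicalType) (f : S -> T) (g : S -> U)
    (x : S) : {for x, continuous f} -> {for x, continuous g} ->
  {for x, continuous (fun z => (f z, g z))}.
Proof. by move=> fx gx; exact: (cvg_pair fx gx). Qed.

Lemma continuous_at_comp (S T U : topologicalType) (f : S -> T) (g : T -> U)
    (x : S) : {for x, continuous f} -> {for f x, continuous g} ->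
  {for x, continuous (fun z => g (f z))}.
Proof. by move=> fx gx; exact: (continuous_comp fx gx). Qed.

Lemma continuous_at_fst (S T U : topologicalType) (f : S -> T * U) (x : S) :
  {for x, continuous f} -> {for x, continuous (fun z => (f z).1)}.
Proof. by move=> fx; apply: (continuous_at_comp fx); exact: cvg_fst. Qed.

Lemma continuous_at_snd (S T U : topologicalType) (f : S -> T * U) (x : S) :
  {for x, continuous f} -> {for x, continuous (fun z => (f z).2)}.
Proof. by move=> fx; apply: (continuous_at_comp fx); exact: cvg_snd. Qed.

Lemma continuous_at_coord (R : realType) (S : topologicalType) (m n : nat)
    (f : S -> 'M[R]_(m, n)) (x : S) i j :
  {for x, continuous f} -> {for x, continuous (fun z => f z i j)}.
Proof.
move=> fx.
exact: (@continuous_comp _ _ _ f (fun M : 'M[R]_(m, n) => M i j) x fx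
  (@coord_continuous _ _ _ _ _ (f x))).
Qed.

Lemma continuous_at_id (S : topologicalType) (x : S) : {for x, continuous id}.
Proof. exact: cvg_id. Qed.

Lemma continuous_at_cst (S T : topologicalType) (a : T) (x : S) :
  {for x, continuous (fun=> a)}.
Proof. exact: cvg_cst. Qed.

Lemma set_homeo_continuous (S T : topologicalType) (X : set S) (Y : set T) f g :
  (forall x, X x -> Y (f x)) -> (forall y, Y y -> X (g y)) ->
  (forall x, X x -> g (f x) = x) -> (forall y, Y y -> f (g y) = y) ->
  (forall x, X x -> {for x, continuous f}) ->
  (forall y, Y y -> {for y, continuous g}) -> set_homeo X Y f g.
Proof.
move=> XY YX fK gK cf cg; split=> //; split.
- by apply/subspace_continuousP => x Xx; apply: (cvg_trans _ (cf x Xx));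
  apply: cvg_app; exact: cvg_within.
- by apply/subspace_continuousP => y Yy; apply: (cvg_trans _ (cg y Yy));
  apply: cvg_app; exact: cvg_within.
Qed.

Section Products.
Variables (R : realType).

Lemma locally_compact_setX (S T : topologicalType) (X : set S) (Y : set T) :
  locally_compact_set X -> locally_compact_set Y ->
  locally_compact_set (X `*` Y).
Proof.
move=> lX lY [x y] [/= Xx Yy].
have [C [U [cC CX Ux UC]]] := lX x Xx; have [D [V [cD DY Vy VD]]] := lY y Yy.
exists (C `*` D), (U `*` V); split.
- exact: compact_setX.
- by move=> z [/CX ? /DY ?].
- by exists (U, V).
- by move=> z [[? ?] [? ?]]; split; [exact: UC|exact: VD].
Qed.

Lemma half_line_locally_compact : locally_compact_set [set t : R | 0 <= t].
Proof.
move=> t t0; exists (`[0, t + 1]%classic), [set s | s < t + 1]; split.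
- exact: segment_compact.
- by move=> s /=; rewrite in_itv /= => /andP[].
- by apply: lt_nbhsl; rewrite ltrDl.
- by move=> s [/= st s0]; rewrite in_itv /= s0 ltW.
Qed.

Variables (T : normedModType R) (Y : set T) (c : int).
Hypotheses (lY : locally_compact_set Y) (cY : has_chi Y c).

(** Removing the closed copy {0} x Y of [Y] from the acyclic [0, oo) x Y leaves 0 - c. *)
Lemma open_half_line_chi : let X := [set z : R * T | 0 < z.1 /\ Y z.2] in
  locally_compact_set X /\ has_chi X (- c).
Proof.
move=> X; pose X0 := [set z : R * T | 0 <= z.1 /\ Y z.2].
pose A := [set z : R * T | z.1 = 0 /\ Y z.2].
have lX0 : locally_compact_set X0.
  have -> : X0 = [set t : R | 0 <= t] `*` Y by [].
  by apply: locally_compact_setX => //; exact: half_line_locally_compact.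
have XE : X = X0 `\` A.
  apply/seteqP; split=> z; rewrite /X /X0 /A /=.
    by move=> [z0 Yz]; split; [split=> //; exact: ltW|move=> [zE _];
      rewrite zE ltxx in z0].
  move=> [[z0 Yz] nA]; split=> //; rewrite lt_neqAle z0 andbT eq_sym.
  by apply/eqP => zE; exact: nA.
have cA : has_chi A c.
  apply: (@has_chi_homeo _ _ Y A (fun y => (0, y)) snd) => //.
  apply: set_homeo_continuous => //.
  - by move=> y [].
  - by move=> [t y] [] /= -> _.
  - move=> y _; apply: continuous_at_pair.
      exact: continuous_at_cst.
    exact: continuous_at_id.
  - by move=> z _; exact: cvg_snd.
split; last first.
  rewrite XE -[- c]add0r; apply: has_chi_setD => //.
  - by move=> z [zE Yz]; split=> //; rewrite zE.
  - move=> z [z0 Yz] clA; split=> //; apply/eqP; rewrite eq_le z0 andbT leNgt.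
    apply/negP => zpos; have [] := clA [set z | 0 < z.1].
      exists ([set t | 0 < t], setT) => /=; last by move=> w [].
      by split; [exact: lt_nbhsr|exact: filterT].
    by move=> w [[wE _]]; rewrite /= wE ltxx.
  - exact: half_line_acyclic.
apply: (locally_compact_open _ lX0).
- exact: uniform_regular.
- by move=> z [z0 Yz]; split=> //; exact: ltW.
- move=> z [z0 Yz]; exists [set z | 0 < z.1].
    exists ([set t | 0 < t], setT) => /=; last by move=> w [].
    by split; [exact: lt_nbhsr|exact: filterT].
  by move=> w [w0 [_ Yw]].
Qed.

End Products.

Lemma orthant_chi (R : realType) (T : normedModType R) (Y : set T) (c : int) d :
  locally_compact_set Y -> has_chi Y c ->
  let X := [set z : 'rV[R]_d * T | (forall i, 0 < z.1 0 i) /\ Y z.2] in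
  locally_compact_set X /\ has_chi X ((-1) ^+ d * c).
Proof.
move=> lY cY; elim: d => [|d [lX cX]] X.
  have h : set_homeo Y X (fun y => (0, y)) snd.
    apply: set_homeo_continuous => //.
    - by move=> y Yy; split=> // -[].
    - by move=> z [].
    - by move=> [u y] [/= _ _]; rewrite (thinmx0 u).
    - move=> y _; apply: continuous_at_pair.
        exact: continuous_at_cst.
      exact: continuous_at_id.
    - by move=> z _; exact: cvg_snd.
  split; first exact: locally_compact_homeo h lY.
  by rewrite expr0 mul1r; exact: has_chi_homeo h cY.
have [lP cP] := open_half_line_chi lX cX.
set P := (X in locally_compact_set X) in lP; set Q := (X in has_chi X _) in cX.
pose f (z : R * ('rV[R]_d * T)) : 'rV[R]_(1 + d) * T :=
  (row_mx (const_mx z.1) z.2.1, z.2.2).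
pose g (z : 'rV[R]_(1 + d) * T) : R * ('rV[R]_d * T) :=
  (z.1 0 (lshift d 0), (rsubmx z.1, z.2)).
have fl z i j : (f z).1 i (lshift d j) = z.1 by rewrite row_mxEl mxE.
have fr z i j : (f z).1 i (rshift 1 j) = z.2.1 i j by rewrite row_mxEr.
have h : set_homeo P X f g.
  apply: set_homeo_continuous.
  - move=> [t [u y]] [/= t0 [u0 Yy]]; split=> //= i.
    rewrite -[i](@splitK 1 d); case: fintype.split => j /=.
      by rewrite -[t]/((t, (u, y)).1) -(fl _ 0 j) in t0.
    by have := u0 j; rewrite -[u]/((t, (u, y)).2.1) -(fr _ 0 j).
  - move=> [u y] [/= u0 Yy]; split; first exact: u0.
    by split=> //= i; rewrite mxE; exact: u0.
  - by move=> [t [u y]] _; rewrite /g fl /= row_mxKr.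
  - move=> [u y] _; rewrite /f /g /=; congr (_, _).
    apply: (etrans _ (@hsubmxK _ 1 1 d u)); congr row_mx.
    by apply/rowP => i; rewrite !mxE ord1.
  - move=> z _; have cz := @continuous_at_id _ z.
    apply: continuous_at_pair; last exact/continuous_at_snd/continuous_at_snd.
    apply: continuous_at_matrix => i j; rewrite -[j](@splitK 1 d).
    case: fintype.split => k /=.
      apply: (eq_continuous_at (f := fun z => z.1)) => [w|]; first exact/esym/fl.
      exact: continuous_at_fst.
    apply: (eq_continuous_at (f := fun z : R * ('rV[R]_d * T) => z.2.1 i k))
      => [w|]; first exact/esym/fr.
    by apply: continuous_at_coord; exact/continuous_at_fst/continuous_at_snd.
  - move=> z _; have cz := @continuous_at_id _ z.
    apply: continuous_at_pair; first exact/continuous_at_coord/continuous_at_fst.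
    apply: continuous_at_pair; last exact: continuous_at_snd.
    apply: continuous_at_matrix => i j.
    apply: (eq_continuous_at (f := fun z : 'rV[R]_(1 + d) * T => z.1 i
      (rshift 1 j))) => [w|].
      by rewrite mxE.
    exact/continuous_at_coord/continuous_at_fst.
split; first exact: locally_compact_homeo h lP.
by rewrite exprS -mulrA mulN1r; exact: has_chi_homeo h cP.
Qed.

(** * Geometry of generalized complexes *)

Section Barycentric.
Variable R : realType.

Lemma continuous_at_add (S : topologicalType) (f g : S -> R) (x : S) :
  {for x, continuous f} -> {for x, continuous g} ->
  {for x, continuous (fun z => f z + g z)}.
Proof. by move=> fx gx; exact: (cvgD fx gx). Qed.

Lemma continuous_at_mul (S : topologicalType) (f g : S -> R) (x : S) :
  {for x, continuous f} -> {for x, continuous g} ->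
  {for x, continuous (fun z => f z * g z)}.
Proof. by move=> fx gx; exact: (cvgM fx gx). Qed.

Lemma continuous_at_sum (S : topologicalType) (I : Type) (r : seq I)
    (f : I -> S -> R) (x : S) : (forall i, {for x, continuous (f i)}) ->
  {for x, continuous (fun z => \sum_(i <- r) f i z)}.
Proof.
move=> fx; elim: r => [|i r IHr].
  apply: (eq_continuous_at (f := fun=> 0)) => [z|]; first by rewrite big_nil.
  exact: continuous_at_cst.
apply: (eq_continuous_at (f := fun z => f i z + \sum_(j <- r) f j z)) => [z|].
  by rewrite big_cons.
exact: continuous_at_add.
Qed.

Lemma continuous_at_mulmx (S : topologicalType) (m n p : nat)
    (f : S -> 'M[R]_(m, n)) (A : 'M[R]_(n, p)) (x : S) :
  {for x, continuous f} -> {for x, continuous (fun z => f z *m A)}.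
Proof.
move=> fx; apply: continuous_at_matrix => i j.
apply: (eq_continuous_at (f := fun z => \sum_k f z i k * A k j)) => [z|].
  by rewrite mxE.
apply: continuous_at_sum => k; apply: continuous_at_mul.
  exact: continuous_at_coord.
exact: continuous_at_cst.
Qed.

Lemma continuous_at_row1 N (S : topologicalType) (f : S -> 'rV[R]_N) (x : S) :
  {for x, continuous f} ->
  {for x, continuous (fun z => row_mx (f z) (const_mx 1 : 'rV[R]_1))}.
Proof.
move=> fx; apply: continuous_at_matrix => i j; rewrite -[j](@splitK N 1).
case: fintype.split => k /=.
  apply: (eq_continuous_at (f := fun z => f z i k)) => [z|].
    by rewrite row_mxEl.
  exact: continuous_at_coord.
apply: (eq_continuous_at (f := fun=> 1 : R)) => [z|].
  by rewrite row_mxEr mxE.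
exact: continuous_at_cst.
Qed.

(** Homogeneous coordinates: affine combinations become linear ones, and affine independence becomes
    freeness of the rows of [vertex_matrix]. *)
Definition affine_row N (x : 'rV[R]_N) : 'rV[R]_(N + 1) :=
  row_mx x (const_mx 1).

Definition vertex_matrix N k (v : 'I_k -> 'rV[R]_N) : 'M[R]_(k, N + 1) :=
  \matrix_i affine_row (v i).

(** The pseudo-inverse gives a function continuous on the whole space. Off the affine span its
    values have no meaning, so [open_hullE] also requires that they reproduce [x]. *)
Definition barycentric N k (v : 'I_k -> 'rV[R]_N) (x : 'rV[R]_N) : 'rV[R]_k :=
  affine_row x *m pinvmx (vertex_matrix v).

Variables (N k : nat) (v : 'I_k -> 'rV[R]_N).

Lemma mul_vertex_matrix (t : 'rV[R]_k) : t *m vertex_matrix v =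
  row_mx (\sum_i t 0 i *: v i) (const_mx (\sum_i t 0 i)).
Proof.
rewrite mulmx_sum_row.
transitivity (\sum_i row_mx (t 0 i *: v i) (const_mx (t 0 i) : 'rV[R]_1)).
  apply: eq_bigr => i _; rewrite rowK scale_row_mx; congr row_mx.
  by apply/rowP => j; rewrite !mxE mulr1.
elim: (index_enum _) => [|i r IHr].
  by rewrite !big_nil -row_mx0; congr row_mx; apply/rowP => j; rewrite !mxE.
rewrite !big_cons IHr add_row_mx; congr row_mx.
by apply/rowP => j; rewrite !mxE.
Qed.

Hypothesis v_indep : affinely_independent v.

Lemma vertex_matrix_free : row_free (vertex_matrix v).
Proof.
apply: inj_row_free => t; rewrite mul_vertex_matrix -row_mx0 => /eq_row_mx[tv t1].
apply/rowP => i; rewrite mxE; apply: (v_indep (t := fun i => t 0 i)) => //.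
by have /rowP/(_ 0) := t1; rewrite !mxE.
Qed.

Lemma affine_combination (t : 'rV[R]_k) x :
  \sum_i t 0 i = 1 /\ x = \sum_i t 0 i *: v i <-> affine_row x = t *m vertex_matrix v.
Proof.
rewrite mul_vertex_matrix; split=> [[-> ->] //|/eq_row_mx[-> /rowP/(_ 0)]].
by rewrite !mxE => <-.
Qed.

Lemma barycentric_eq (t : 'rV[R]_k) x :
  affine_row x = t *m vertex_matrix v -> barycentric v x = t.
Proof. by move=> xt; rewrite /barycentric xt mulmxKp //;
  exact: vertex_matrix_free. Qed.

Lemma open_hullE x : open_hull v x <->
  (forall i, 0 < barycentric v x 0 i) /\
  affine_row x = barycentric v x *m vertex_matrix v.
Proof.
split=> [[t [t1 t0 xE]]|[b0 xE]]; last first.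
  have /affine_combination[b1 xs] := xE.
  by exists (fun i => barycentric v x 0 i); split.
have xt : affine_row x = (\row_i t i) *m vertex_matrix v.
  apply/affine_combination; split.
    by rewrite -[RHS]t1; apply: eq_bigr => i _; rewrite mxE.
  by rewrite xE; apply: eq_bigr => i _; rewrite mxE.
by rewrite (barycentric_eq xt); split=> // i; rewrite mxE.
Qed.

Lemma continuous_at_barycentric i x :
  {for x, continuous (fun z => barycentric v z 0 i)}.
Proof.
apply: continuous_at_coord; apply: continuous_at_mulmx; apply: continuous_at_row1.
exact: continuous_at_id.
Qed.

End Barycentric.

Section OpenSimplices.
Variables (R : realType) (N : nat).
Implicit Types (r s t : set 'rV[R]_N).

Lemma open_hull_sub_dim d e (v : 'I_d.+1 -> 'rV[R]_N) (w : 'I_e -> 'rV[R]_N) :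
  affinely_independent v -> affinely_independent w ->
  open_hull v `<=` open_hull w -> (d.+1 <= e)%N.
Proof.
move=> vi wi vw.
have sub x : open_hull v x -> (affine_row x <= vertex_matrix w)%MS.
  by move=> /vw/(open_hullE wi)[_ ->]; exact: submxMl.
suff /mxrankS : (vertex_matrix v <= vertex_matrix w)%MS.
  rewrite (eqP (vertex_matrix_free vi)) (eqP (vertex_matrix_free wi)).
  exact.
pose c : R := (d.+1%:R)^-1.
have c0 : 0 < c by rewrite invr_gt0 ltr0n.
have sumc : \sum_(j < d.+1) c = 1.
  by rewrite sumr_const card_ord -mulr_natr mulVf // pnatr_eq0.
pose u : 'rV[R]_d.+1 := const_mx c.
have comb (t : 'rV[R]_d.+1) : (forall i, 0 < t 0 i) -> \sum_i t 0 i = 1 ->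
    (t *m vertex_matrix v <= vertex_matrix w)%MS.
  move=> t0 t1.
  have /(affine_combination v) <- :
      \sum_i t 0 i = 1 /\ \sum_i t 0 i *: v i = \sum_i t 0 i *: v i by [].
  by apply: sub; exists (fun i => t 0 i); split.
have u1 : \sum_i u 0 i = 1 by rewrite -[RHS]sumc; apply: eq_bigr => i _; rewrite mxE.
have uw : (u *m vertex_matrix v <= vertex_matrix w)%MS.
  by apply: comb => // i; rewrite mxE.
apply/row_subP => i.
(* A vertex is in general not in the open hull, but it is twice its midpoint with the barycenter
   minus the barycenter, and these two points are. *)
have -> : row i (vertex_matrix v) =
    2%:R *: ((2^-1 *: (u + delta_mx 0 i)) *m vertex_matrix v) - u *m vertex_matrix v.
  rewrite -scalemxAl scalerA divff ?scale1r ?pnatr_eq0 //.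
  by rewrite mulmxDl addrC addKr -rowE.
apply: addmx_sub; last by rewrite -scaleN1r; exact: scalemx_sub.
apply: scalemx_sub; apply: comb => [j|].
  by rewrite !mxE mulr_gt0 ?invr_gt0 ?ltr0n // ltr_pwDl.
under eq_bigr => j _ do rewrite mxE mxE.
rewrite -mulr_sumr big_split /= u1 (bigD1 i) //= big1 => [|j ji].
  by rewrite mxE !eqxx addr0 -[1 + 1]/(2%:R : R) mulVf // pnatr_eq0.
by rewrite mxE (negbTE ji) andbF.
Qed.

Lemma open_simplex_dim_uniq d e s : open_simplex d s -> open_simplex e s -> d = e.
Proof.
move=> [v [vi ->]] [w [wi vw]]; apply/eqP; rewrite eqn_leq.
have := open_hull_sub_dim vi wi; have := open_hull_sub_dim wi vi.
by rewrite vw !ltnS => -> // ->.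
Qed.

Lemma open_simplex_dim_le d s : open_simplex d s -> (d <= N)%N.
Proof.
move=> [v [vi _]]; have := rank_leq_col (vertex_matrix v).
by rewrite (eqP (vertex_matrix_free vi)) addn1.
Qed.

Lemma open_simplex_nonempty d s : open_simplex d s -> s !=set0.
Proof.
move=> [v [_ ->]]; pose c : R := (d.+1%:R)^-1.
exists (\sum_i c *: v i), (fun=> c); split=> //.
  by rewrite sumr_const card_ord -mulr_natr mulVf // pnatr_eq0.
by move=> _; rewrite invr_gt0 ltr0n.
Qed.

Lemma affinely_independent_comp d c (v : 'I_d -> 'rV[R]_N) (i : 'I_c -> 'I_d) :
  affinely_independent v -> injective i -> affinely_independent (v \o i).
Proof.
move=> vi inj t t0 tv j.
have push_sum (W : lmodType R) (h : 'I_d -> W) :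
    \sum_l (\sum_(j | i j == l) t j) *: h l = \sum_j t j *: h (i j).
  rewrite (partition_big i xpredT) //=; apply: eq_bigr => l _.
  by rewrite scaler_suml; apply: eq_bigr => m /eqP <-.
have sum0 : \sum_l \sum_(j | i j == l) t j = 0.
  by rewrite -[RHS]t0 [RHS](partition_big i xpredT).
have comb0 : \sum_l (\sum_(j | i j == l) t j) *: v l = 0 by rewrite push_sum.
by have := vi _ sum0 comb0 (i j); rewrite (big_pred1 j) => [|m];
  rewrite ?(inj_eq inj).
Qed.

Lemma open_face_bij d c (v : 'I_d.+1 -> 'rV[R]_N) (i : 'I_c.+1 -> 'I_d.+1) :
  bijective i -> open_hull (v \o i) = open_hull v.
Proof.
move=> [i' iK i'K]; apply/seteqP; split=> x [t [t1 t0 ->]].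
  exists (t \o i'); split; last 1 first.
  - rewrite (reindex i) /=; last by exists i' => j _.
    by apply: eq_bigr => j _; rewrite iK.
  - by rewrite (reindex i) /= -?[RHS]t1; [apply: eq_bigr => j _;
    rewrite iK|exists i' => j _].
  - by move=> j; exact: t0.
exists (t \o i); split; last 1 first.
- rewrite (reindex i) /=; last by exists i' => j _.
  by [].
- by rewrite -[RHS]t1 [RHS](reindex i) //; exists i' => j _.
- by move=> j; exact: t0.
Qed.

Lemma barycentric_face d c (v : 'I_d -> 'rV[R]_N) (i : 'I_c -> 'I_d) x l :
  affinely_independent v -> injective i -> open_hull (v \o i) x ->
  affine_row x = barycentric v x *m vertex_matrix v /\
  ((exists j, l = i j) -> 0 < barycentric v x 0 l) /\
  ((forall j, l <> i j) -> barycentric v x 0 l = 0).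
Proof.
move=> vi inj [t [t1 t0 xE]].
pose u : 'rV[R]_d := \row_l \sum_(j | i j == l) t j.
have xu : affine_row x = u *m vertex_matrix v.
  apply/affine_combination; split.
    under eq_bigr do rewrite mxE.
    by rewrite -t1 [RHS](partition_big i xpredT).
  rewrite xE (partition_big i xpredT) //=; apply: eq_bigr => m _.
  by rewrite mxE scaler_suml; apply: eq_bigr => j /eqP <-.
rewrite (barycentric_eq vi xu); split=> //; split.
  move=> [j ->]; rewrite mxE (big_pred1 j) // => m.
  by rewrite (inj_eq inj).
by move=> li; rewrite mxE big1 // => j /eqP ij; case: (li j).
Qed.

(** The barycentric coordinate of a vertex missing in [r] would vanish on [r], hence on its closure,
    but it is positive at [x]. *)
Lemma open_face_interior r s x : open_face r s -> s x -> closure r x -> r = s.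
Proof.
move=> [d [v [c [i [vi -> inj ->]]]]] sx rx.
have surj l : exists j, l = i j.
  apply: contrapT => /forallNP li.
  have [b0 _] := (open_hullE vi x).1 sx.
  suff : barycentric v x 0 l = 0 by move=> bl; have := b0 l; rewrite bl ltxx.
  have cl : closed ((fun z => barycentric v z 0 l) @^-1` [set y | y = 0]).
    apply: preimage_closed; last exact: closed_eq.
    by move=> z _; exact: continuous_at_barycentric.
  apply: cl; apply: closure_subset rx => z rz.
  by have [_ [_ H]] := barycentric_face l vi inj rz; exact: H.
apply: open_face_bij; apply: inj_card_bij => //.
rewrite -(card_codom inj); apply: subset_leq_card; apply/fintype.subsetP => l _.
by have [j ->] := surj l; exact: codom_f.
Qed.

Variable K : set (set 'rV[R]_N).
Hypothesis cK : generalized_complex K.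

(** The closures meet in the closure of a common face; it contains the point [x] of the open simplex
    [s], so this face is [s] itself. *)
Lemma complex_face s t x : K s -> K t -> s x -> closure t x ->
  open_face s t /\ s `<=` closure t.
Proof.
case: cK => _ _ inter Ks Kt sx tx.
have [st0|[r [rs rt st]]] := inter s t Ks Kt.
  have : (closure s `&` closure t) x by split=> //; exact: subset_closure.
  by rewrite st0.
have rx : closure r x by rewrite -st; split=> //; exact: subset_closure.
rewrite -(open_face_interior rs sx rx) in st *; split=> // y ry.
have : closure r y by exact: subset_closure.
by rewrite -st => -[].
Qed.

Lemma complex_face_dim s t d e x : K s -> K t -> open_simplex d s ->
  open_simplex e t -> (e <= d)%N -> s x -> closure t x -> s = t.
Proof.
move=> Ks Kt ds et ed sx tx.
have [[d' [w [c [i [wi tE inj sE]]]]] _] := complex_face Ks Kt sx tx.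
have dc : d = c.
  apply: open_simplex_dim_uniq ds _; exists (w \o i); split=> //.
  exact: affinely_independent_comp.
have ed' : e = d' by apply: open_simplex_dim_uniq et _; exists w.
rewrite sE tE; apply: open_face_bij; apply: inj_card_bij => //.
by rewrite !card_ord ltnS -dc -ed'.
Qed.

Lemma complex_disjoint s t x : K s -> K t -> s x -> t x -> s = t.
Proof.
move=> Ks Kt sx tx; case: (cK) => _ simp _.
have [d ds] := simp s Ks; have [e et] := simp t Kt.
have [ed|/ltnW de] := leqP e d.
  by apply: (complex_face_dim Ks Kt ds et ed sx); exact: subset_closure.
by apply/esym/(complex_face_dim Kt Ks et ds de tx); exact: subset_closure.
Qed.

(* The complex is locally a product along each of its open simplices. *)
Lemma complex_homogeneous s x y : K s -> s x -> s y ->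
  \forall z \near (0 : 'rV[R]_N), realization K (x + z) <-> realization K (y + z).
Proof.
move=> Ks sx sy.
have far u t : ~ closure t u -> \forall z \near (0 : 'rV[R]_N), ~ t (u + z).
  move=> /not_closureP[B uB tB0].
  have : \forall z \near u, B z by [].
  rewrite (near_shift 0) subr0; apply: filterS => z /= Bz tz.
  have : (t `&` B) (u + z) by split=> //; rewrite addrC.
  by rewrite tB0.
have one t : K t ->
    \forall z \near (0 : 'rV[R]_N), t (x + z) <-> t (y + z).
  move=> Kt; have [tx|ntx] := pselect (closure t x); last first.
    have nty : ~ closure t y.
      move=> ty; apply: ntx; have [_ st] := complex_face Ks Kt sy ty; exact: st.
    by apply: filterS2 (far _ _ ntx) (far _ _ nty) => z nx ny; split.
  have [[d [w [c [i [wi tE inj sE]]]]] _] := complex_face Ks Kt sx tx.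
  pose lin (z : 'rV[R]_N) := row_mx z (0 : 'rV[R]_1) *m pinvmx (vertex_matrix w).
  (* At a point of [s] the coordinates of the vertices of [s] are positive and remain so nearby,
     while the others are zero. Hence lying in [t] after a small shift [z] depends on [z] alone,
     through [Q]. *)
  pose Q z := (forall l, (forall j, l <> i j) -> 0 < lin z 0 l) /\
    row_mx z (0 : 'rV[R]_1) = lin z *m vertex_matrix w.
  have near_face u : s u -> \forall z \near (0 : 'rV[R]_N), t (u + z) <-> Q z.
    rewrite sE => su.
    have addE z : affine_row (u + z) = affine_row u + row_mx z (0 : 'rV[R]_1).
      by rewrite add_row_mx addr0.
    have baryE z : barycentric w (u + z) = barycentric w u + lin z.
      by rewrite /barycentric addE mulmxDl.
    have [uE _] : affine_row u = barycentric w u *m vertex_matrix w /\ True.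
      by split=> //; have [] := barycentric_face ord0 wi inj su.
    have : \forall z \near (0 : 'rV[R]_N), forall l : 'I_d.+1,
        (exists j, l = i j) -> 0 < barycentric w (u + z) 0 l.
      apply: (@filter_forall _ _ (fun (l : 'I_d.+1) z => (exists j, l = i j) ->
        0 < barycentric w (u + z) 0 l) _ (nbhs_filter (0 : 'rV[R]_N))) => l.
      have [[j lj]|nl] := pselect (exists j, l = i j); last first.
        by apply: filterE => z /nl.
      have bl : 0 < barycentric w u 0 l.
        have [_ [H _]] := barycentric_face l wi inj su.
        by apply: H; exists j.
      have : \forall z \near u, 0 < barycentric w z 0 l.
        exact: (@continuous_at_barycentric _ _ _ w l u _ (lt_nbhsr bl)).
      rewrite (near_shift 0) subr0; apply: filterS => z /= zl _.
      by rewrite addrC.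
    apply: filterS => z zi; rewrite tE (open_hullE wi) addE baryE mulmxDl -uE /Q.
    split=> [[b0 /addrI zE]|[b0 <-]]; split=> // l.
      move=> li; have [_ [_ /(_ li) ul]] := barycentric_face l wi inj su.
      by have := b0 l; rewrite mxE ul add0r.
    have [il|/forallNP li] := pselect (exists j, l = i j).
      by rewrite -baryE; exact: zi.
    have [_ [_ /(_ li) ul]] := barycentric_face l wi inj su.
    by rewrite mxE ul add0r; exact: b0.
  apply: filterS2 (near_face x sx) (near_face y sy) => z hx hy.
  by rewrite hx hy.
have [fK _ _] := cK.
have : \forall z \near (0 : 'rV[R]_N), forall t, K t -> t (x + z) <-> t (y + z).
  have := @filter_bigI _ _ (fset_set K)
    (fun t => [set z | t (x + z) <-> t (y + z)]) _ (nbhs_filter (0 : 'rV[R]_N)).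
  move=> H; apply: filterS (H _) => [z Hz t Kt|t].
    by apply: Hz; rewrite /= in_fset_set ?inE.
  by rewrite in_fset_set // inE => /one.
by apply: filterS => z Hz; split=> -[t Kt]; [rewrite Hz|rewrite -Hz] => // tz;
  exists t.
Qed.

End OpenSimplices.

Section OpenHullChi.
Variables (R : realType) (N d : nat) (v : 'I_d.+1 -> 'rV[R]_N).
Hypothesis vi : affinely_independent v.
Variables (T : normedModType R) (Y : set T) (c : int).
Hypotheses (lY : locally_compact_set Y) (cY : has_chi Y c).

(** The open simplex is homeomorphic to the positive orthant: [f] normalizes (1, u) to coordinates
    of sum 1, and [g] divides by the coordinate of the first vertex. *)
Lemma open_hull_chi : let X := [set z : 'rV[R]_N * T | open_hull v z.1 /\ Y z.2] in
  locally_compact_set X /\ has_chi X ((-1) ^+ d * c).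
Proof.
move=> X; pose P := [set z : 'rV[R]_d * T | (forall i, 0 < z.1 0 i) /\ Y z.2].
have [lP cP] : locally_compact_set P /\ has_chi P ((-1) ^+ d * c).
  exact: orthant_chi.
pose S (u : 'rV[R]_d) := 1 + \sum_i u 0 i.
pose coef (u : 'rV[R]_d) : 'rV[R]_d.+1 :=
  \row_i ((S u)^-1 * oapp (fun j => u 0 j) 1 (unlift ord0 i)).
pose f (z : 'rV[R]_d * T) : 'rV[R]_N * T :=
  (\sum_i coef z.1 0 i *: v i, z.2).
pose g (z : 'rV[R]_N * T) : 'rV[R]_d * T :=
  (\row_i (barycentric v z.1 0 (lift ord0 i) * (barycentric v z.1 0 ord0)^-1), z.2).
have S0 (u : 'rV[R]_d) : (forall i, 0 < u 0 i) -> 0 < S u.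
  by move=> u0; rewrite ltr_pwDl // sumr_ge0 // => i _; exact: ltW.
have coef0 u : coef u 0 ord0 = (S u)^-1 by rewrite mxE unlift_none mulr1.
have coefS u i : coef u 0 (lift ord0 i) = (S u)^-1 * u 0 i by rewrite mxE liftK.
have coef1 (u : 'rV[R]_d) : (forall i, 0 < u 0 i) -> \sum_i coef u 0 i = 1.
  move=> /S0 Su; rewrite big_ord_recl coef0.
  under eq_bigr do rewrite coefS.
  by rewrite -mulr_sumr -{1}[(S u)^-1]mulr1 -mulrDr mulVf // gt_eqF.
have bary_f (u : 'rV[R]_d) : (forall i, 0 < u 0 i) ->
    barycentric v (\sum_i coef u 0 i *: v i) = coef u.
  move=> u0; apply: barycentric_eq => //; apply/affine_combination.
  by split=> //; exact: coef1.
have h : set_homeo P X f g.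
  apply: set_homeo_continuous.
  - move=> [u y] [/= u0 Yy]; split=> //=; exists (fun i => coef u 0 i); split=> //.
      exact: coef1.
    move=> i; case: (unliftP ord0 i) => [j ->|->].
      by rewrite coefS mulr_gt0 // invr_gt0 S0.
    by rewrite coef0 invr_gt0 S0.
  - move=> [x y] [/= /(open_hullE vi)[b0 _] Yy]; split=> //= i.
    by rewrite mxE mulr_gt0 // invr_gt0.
  - move=> [u y] [/= u0 Yy]; rewrite /g /f /= bary_f //; congr (_, _).
    apply/rowP => i; rewrite mxE coefS coef0 invrK mulrC mulrA divff ?mul1r //.
    by rewrite gt_eqF // S0.
  - move=> [x y] [/= /(open_hullE vi)[b0 xE] Yy]; rewrite /g /f /=; congr (_, _).
    have [b1 xs] := (affine_combination v _ _).2 xE; rewrite [RHS]xs.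
    pose u : 'rV[R]_d :=
      \row_i (barycentric v x 0 (lift ord0 i) * (barycentric v x 0 ord0)^-1).
    rewrite -/u.
    have Su : (S u)^-1 = barycentric v x 0 ord0.
      have SE : S u * barycentric v x 0 ord0 = 1.
        rewrite /S mulrDl mul1r mulr_suml -b1 big_ord_recl; congr (_ + _).
        by apply: eq_bigr => i _; rewrite mxE mulfVK // gt_eqF.
      have Su0 : S u != 0.
        by apply: contraTneq (oner_neq0 R) => Su0; rewrite -SE Su0 mul0r eqxx.
      by apply: (mulfI Su0); rewrite mulfV.
    apply: eq_bigr => i _; congr (_ *: _).
    case: (unliftP ord0 i) => [j ->|->]; last by rewrite coef0 Su.
    by rewrite coefS Su [u 0 j]mxE mulrCA divff ?mulr1 // gt_eqF.
  - move=> z [z0 Yz]; have cz := @continuous_at_id _ z.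
    apply: continuous_at_pair; last exact: continuous_at_snd.
    have cu i : {for z, continuous (fun z : 'rV[R]_d * T => z.1 0 i)}.
      exact/continuous_at_coord/continuous_at_fst.
    have cS : {for z, continuous (fun z : 'rV[R]_d * T => (S z.1)^-1)}.
      apply: continuousV; first by rewrite gt_eqF // S0.
      apply: continuous_at_add; first exact: continuous_at_cst.
      exact: continuous_at_sum.
    apply: continuous_at_matrix => i j.
    apply: (eq_continuous_at (f := fun z : 'rV[R]_d * T =>
      \sum_k coef z.1 0 k * v k i j)) => [w|].
      by rewrite /= summxE; apply: eq_bigr => k _; rewrite [RHS]mxE.
    apply: continuous_at_sum => k; apply: continuous_at_mul;
      last exact: continuous_at_cst.
    case: (unliftP ord0 k) => [l ->|->].
      apply: (eq_continuous_at (f := fun z : 'rV[R]_d * T => (S z.1)^-1 * z.1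
        0 l)) => [w|].
        by rewrite coefS.
      exact: continuous_at_mul.
    by apply: (eq_continuous_at (f := fun z : 'rV[R]_d * T => (S z.1)^-1)) => [w|].
  - move=> z [/(open_hullE vi)[b0 _] Yz]; have cz := @continuous_at_id _ z.
    apply: continuous_at_pair; last exact: continuous_at_snd.
    have cb i : {for z, continuous (fun z : 'rV[R]_N * T => barycentric v z.1 0 i)}.
      apply: (@continuous_at_comp _ _ _ (fun z : 'rV[R]_N * T => z.1)
        (fun x => barycentric v x 0 i)); first exact: continuous_at_fst.
      exact: continuous_at_barycentric.
    apply: continuous_at_matrix => i j.
    apply: (eq_continuous_at (f := fun z : 'rV[R]_N * T =>
      barycentric v z.1 0 (lift ord0 j) * (barycentric v z.1 0 ord0)^-1)) => [w|].
      by rewrite [RHS]mxE.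
    by apply: continuous_at_mul => //; apply: continuousV => //; rewrite gt_eqF.
split; first exact: locally_compact_homeo h lP.
exact: has_chi_homeo h cP.
Qed.

End OpenHullChi.

(** * Characteristics of complexes and bundles *)

Section EulerCharOfSubcomplexes.
Variables (R : realType) (N : nat).
Implicit Types (K L : set (set 'rV[R]_N)) (s t : set 'rV[R]_N).

Lemma complex_euler_charID K L : finite_set K -> L `<=` K ->
  complex_euler_char K = complex_euler_char L + complex_euler_char (K `\` L).
Proof.
move=> fK LK; rewrite -big_split /=; apply: eq_bigr => i _.
rewrite -mulrDr; congr (_ * _); rewrite -PoszD; congr (Posz _).
have fKi (M : set (set 'rV[R]_N)) : M `<=` K ->
    finite_set [set s | M s /\ open_simplex i s].
  by move=> MK; apply: (sub_finite_set _ fK) => s [/MK].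
rewrite -(cardfsID (fset_set [set s | L s /\ open_simplex i s])).
rewrite -fset_setI; [|exact: fKi|exact: fKi].
rewrite -fset_setD; [|exact: fKi|exact: fKi].
congr (_ + _)%N; congr (size (enum_fset (fset_set _))); apply/seteqP; split=> s /=.
- by move=> [_ [Ls si]]; split.
- by move=> [Ls si]; split=> //; split=> //; exact: LK.
- by move=> [[Ks si] nL]; split=> //; split=> // Ls; exact: nL.
- by move=> [[Ks nL] si]; split=> // -[].
Qed.

Lemma complex_euler_char1 d s :
  open_simplex d s -> complex_euler_char [set s] = (-1) ^+ d.
Proof.
move=> ds; have dN : (d < N.+1)%N by rewrite ltnS; exact: open_simplex_dim_le ds.
rewrite /complex_euler_char (bigD1 (Ordinal dN)) //= big1 ?addr0 => [|i id].
  have -> : [set s' | [set s] s' /\ open_simplex d s'] = [set s].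
    by apply/seteqP; split=> [s' []//|_ ->].
  by rewrite fset_set1 cardfs1 mulr1.
have -> : [set s' | [set s] s' /\ open_simplex i s'] = set0.
  apply/seteqP; split=> // s' [-> si].
  by move/eqP: id; case; apply: val_inj => /=; exact: open_simplex_dim_uniq si ds.
by rewrite fset_set0 cardfs0 mulr0.
Qed.

Lemma complex_euler_char0 : complex_euler_char (set0 : set (set 'rV[R]_N)) = 0.
Proof.
rewrite /complex_euler_char big1 // => i _.
have -> : [set s : set 'rV[R]_N | set0 s /\ open_simplex i s] = set0.
  by apply/seteqP; split=> // s [].
by rewrite fset_set0 cardfs0 mulr0.
Qed.

Lemma sub_generalized_complex K L :
  generalized_complex K -> L `<=` K -> generalized_complex L.
Proof.
move=> [fK sK iK] LK; split.
- exact: sub_finite_set fK.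
- by move=> s /LK/sK.
- by move=> s t /LK Ks /LK Kt; exact: iK.
Qed.

Lemma complex_max_simplex K : generalized_complex K -> K !=set0 ->
  exists s d, [/\ K s, open_simplex d s &
    forall t e, K t -> open_simplex e t -> (e <= d)%N].
Proof.
move=> [fK sK iK] [s0 Ks0].
pose P d := `[< exists s, K s /\ open_simplex d s >].
have exP : exists d, P d.
  by have [d ds] := sK s0 Ks0; exists d; apply/asboolP; exists s0.
have bP d : P d -> (d <= N)%N by move=> /asboolP[s [_ /open_simplex_dim_le]].
case: (ex_maxnP exP bP) => d /asboolP[s [Ks ds]] dmax.
exists s, d; split=> // t e Kt et; apply: dmax; apply/asboolP; by exists t.
Qed.

(** If [x] were in the closure of another simplex, [s] would be a face of it, and equal to it by
    maximality of the dimension. *)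
Lemma max_simplex_nbhs K s d x : generalized_complex K -> K s ->
  open_simplex d s -> (forall t e, K t -> open_simplex e t -> (e <= d)%N) ->
  s x -> exists2 B, nbhs x B & forall t, K t -> t != s -> t `&` B = set0.
Proof.
move=> cK Ks ds dmax sx; have [fK sK iK] := cK.
have /choice[B HB] : forall t, exists B, nbhs x B /\
    (K t -> t != s -> t `&` B = set0).
  move=> t; have [Kt|nKt] := pselect (K t); last by exists setT; split=> //;
    exact: filterT.
  have [->|ts] := eqVneq t s; first by exists setT; split=> //; exact: filterT.
  have [e et] := sK t Kt.
  have /not_closureP[C Cx tC0] : ~ closure t x.
    move=> tx; move/eqP: ts; apply; apply/esym.
    exact: (complex_face_dim cK Ks Kt ds et (dmax t e Kt et) sx tx).
  by exists C.
exists (\bigcap_(t in [set` fset_set K]) B t).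
  by apply: filter_bigI => t _; case: (HB t).
move=> t Kt ts; apply/seteqP; split=> // y [ty By].
have [_ /(_ Kt ts) <-] := HB t; split=> //.
by apply: By; rewrite /= in_fset_set ?inE.
Qed.

End EulerCharOfSubcomplexes.

(* Additivity along the open simplices of [K], removed one by one in order of
   decreasing dimension. *)
Lemma map_to_complex_chi (R : realType) (T : normedModType R) (N : nat)
    (K : set (set 'rV[R]_N)) (X : set T) (q : T -> 'rV[R]_N) (c : int) :
  generalized_complex K -> locally_compact_set X -> {within X, continuous q} ->
  (forall x, X x -> realization K (q x)) ->
  (forall s d, K s -> open_simplex d s ->
     has_chi (X `&` q @^-1` s) ((-1) ^+ d * c)) ->
  has_chi X (complex_euler_char K * c).
Proof.
have [n] := ubnP #|` fset_set K|; elim: n => // n IHn in K X *.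
move=> Kn cK lX cq qK chi_s.
have [fK sK iK] := cK.
have [K0|/set0P Kn0] := eqVneq K set0.
  have -> : X = set0.
    by apply/seteqP; split=> // x /qK[s]; rewrite K0.
  by rewrite K0 complex_euler_char0 mul0r; exact: has_chi_set0.
have [s [d [Ks ds dmax]]] := complex_max_simplex cK Kn0.
have sK1 : [set s] `<=` K by move=> _ ->.
pose L := K `\` [set s]; have LK : L `<=` K by move=> t [].
(* This is closed in [X], because [s] has maximal dimension and so is open in the realization of
   [K]. *)
pose A := X `&` q @^-1` (realization L).
have XA : X `\` A = X `&` q @^-1` s.
  apply/seteqP; split=> x [Xx].
    move=> nA; split=> //; have [t Kt tx] := qK x Xx.
    have [<- //|ts] := eqVneq t s.
    by exfalso; apply: nA; split=> //; exists t => //; split=> // /eqP; apply/negP.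
  move=> sx; split=> // -[_ [t [Kt nts] tx]]; apply: nts.
  exact: (complex_disjoint cK Kt Ks tx sx).
have AX : A `<=` X by move=> x [].
have cA x : X x -> closure A x -> A x.
  move=> Xx clA; apply: contrapT => nAx.
  have sx : s (q x) by have : (X `\` A) x by []; rewrite XA => -[].
  have [B Bx HB] := max_simplex_nbhs cK Ks ds dmax sx.
  have /subspace_continuousP/(_ x Xx _ Bx) := cq.
  rewrite nbhs_simpl /= => /clA[z [[Xz [t [Kt nts] tz]] Bz]].
  suff : (t `&` B) (q z) by rewrite HB //; apply/eqP.
  by split=> //; exact: Bz.
rewrite (complex_euler_charID fK sK1) (complex_euler_char1 ds) mulrDl.
apply: (has_chi_add lX AX cA); last by rewrite XA; exact: chi_s.
apply: IHn.
- rewrite fset_setD // fset_set1 -ltnS (leq_trans _ Kn) // ltnS.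
  by rewrite [leqRHS](cardfsD1 s) in_fset_set // (mem_set Ks) add1n ltnS.
- exact: sub_generalized_complex cK LK.
- exact: locally_compact_closed lX AX cA.
- exact: continuous_subspaceW cq.
- by move=> x [].
- move=> t e Lt et.
  have -> : A `&` q @^-1` t = X `&` q @^-1` t.
    apply/seteqP; split=> x [Xx tx]; first by split=> //; case: Xx.
    by split=> //; split=> //; exists t.
  by apply: chi_s => //; exact: LK.
Qed.

(** * The locally compact part of a space *)

Section LocallyCompactPart.
Variable T : topologicalType.
Hypothesis regT : regular_space T.
Implicit Types X O : set T.

Definition locally_compact_part X : set T :=
  [set x | X x /\ locally_compact_at X x].

Lemma locally_compact_at_open X O x : O `<=` X -> O x ->
  (exists2 U, nbhs x U & U `&` X `<=` O) ->
  locally_compact_at X x <-> locally_compact_at O x.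
Proof.
move=> OX Ox [V Vx VO]; split=> [[C [U [cC CX Ux UC]]]|[C [U [cC CO Ux UC]]]].
  have [W Wx WV] := regT Vx.
  exists (C `&` closure W), (U `&` W); split.
  - by apply: compact_closedI => //; exact: closed_closure.
  - by move=> y [Cy /WV Vy]; apply: VO; split=> //; exact: CX.
  - exact: filterI.
  - move=> y [[Uy Wy] Oy]; split; last exact: subset_closure.
    by apply: UC; split=> //; exact: OX.
exists C, (U `&` V); split=> //.
- exact: subset_trans CO OX.
- exact: filterI.
- by move=> y [[Uy Vy] Xy]; apply: UC; split=> //; exact: VO.
Qed.

Lemma locally_compact_part_open X x : locally_compact_part X x ->
  exists2 U, nbhs x U & U `&` X `<=` locally_compact_part X.
Proof.
move=> [Xx [C [U [cC CX Ux UC]]]]; exists U°; first exact: nbhs_interior.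
by move=> y [Uy Xy]; split=> //; exists C, U.
Qed.

Lemma locally_compact_part_locally_compact X :
  locally_compact_set (locally_compact_part X).
Proof.
move=> x Px; have Xx := Px; case: Xx => Xx lx.
apply/(locally_compact_at_open (X := X)) => //; first by move=> y [].
exact: locally_compact_part_open.
Qed.

End LocallyCompactPart.

(** A compact neighbourhood of (x, y) projects onto one of [y], as the slice over [x] shows. For the
    converse, multiply by a compact neighbourhood of [x]. *)
Lemma locally_compact_at_setX (S T : topologicalType) (X : set S) (Y : set T) x y :
  locally_compact_at X x -> X x ->
  locally_compact_at (X `*` Y) (x, y) <-> locally_compact_at Y y.
Proof.
move=> [C [U [cC CX Ux UC]]] Xx;
  split=> [[D [V [cD DXY [[V1 V2] /= [V1x V2y] V12] VD]]]|[D [V [cD DY Vy VD]]]].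
  exists [set z.2 | z in D], V2; split=> //.
  - apply: continuous_compact => //; apply: continuous_subspaceT => z.
    exact: cvg_snd.
  - by move=> _ [z /DXY[_ Yz] <-].
  - move=> z [V2z Yz]; exists (x, z) => //; apply: VD; split=> //.
    by apply: V12; split=> //=; exact: nbhs_singleton V1x.
exists (C `*` D), (U `*` V); split.
- exact: compact_setX.
- by move=> z [/CX ? /DY ?].
- by exists (U, V).
- by move=> z [[? ?] [? ?]]; split; [exact: UC|exact: VD].
Qed.

(** The set looks alike only near [x] and [y], so the compact neighbourhood is first cut down to a
    closed neighbourhood on which both copies agree, then translated. *)
Lemma locally_compact_at_translate (R : realType) (T : normedModType R) (X : set T)
    x y : locally_compact_at X x ->
  (\forall z \near (0 : T), X (x + z) <-> X (y + z)) -> locally_compact_at X y.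
Proof.
move=> [C [U [cC CX Ux UC]]] XW.
have [V V0 clVW] := uniform_regular XW.
have tr_cont (a : T) : continuous (fun w => w + a).
  by move=> w; apply: cvgD; [exact: cvg_id|exact: cvg_cst].
pose D := C `&` (fun w => w - x) @^-1` (closure V).
exists [set w - x + y | w in D], [set w | V (w - y) /\ U (w - y + x)]; split.
- apply: continuous_compact.
    by apply: continuous_subspaceT => w;
      exact: (continuous_comp (tr_cont (- x) w) (tr_cont y _)).
  apply: compact_closedI => //; apply: preimage_closed; last exact: closed_closure.
  by move=> w _; exact: tr_cont.
- move=> _ [w [Cw /clVW Vw] <-]; rewrite addrC; apply/Vw; rewrite addrC subrK.
  exact: CX.
- have cV : \forall w \near y, V (w - y).
    have Vy : nbhs (y - y) V by rewrite subrr.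
    exact: tr_cont (- y) y _ Vy.
  have cU : \forall w \near y, U (w - y + x).
    have Uy : nbhs (y - y + x) U by rewrite subrr add0r.
    exact: (continuous_comp (tr_cont (- y) y) (tr_cont x _)) _ Uy.
  exact: filterI cV cU.
- move=> w [[Vw Uw] Xw]; exists (w - y + x); last by rewrite addrK subrK.
  split; last by rewrite /= addrK; exact: subset_closure.
  apply: UC; split=> //; rewrite addrC.
  by apply/(clVW (w - y)); [exact: subset_closure|rewrite addrC subrK].
Qed.

Section LocallyCompactPartOfComplex.
Variables (R : realType) (N : nat).
Implicit Types (K : set (set 'rV[R]_N)) (s : set 'rV[R]_N).

Lemma open_simplex_chi d s : open_simplex d s ->
  locally_compact_set s /\ has_chi s ((-1) ^+ d).
Proof.
move=> [v [vi ->]].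
have l0 : locally_compact_set [set (0 : R^o)].
  move=> x ->; exists [set 0], setT; split=> //; first exact: compact_set1.
  exact: filterT.
pose X := [set z : 'rV[R]_N * R^o | open_hull v z.1 /\ [set 0] z.2].
have [lX cX] : locally_compact_set X /\ has_chi X ((-1) ^+ d * 1).
  exact: open_hull_chi l0 (has_chi_set1 _).
have h : set_homeo X (open_hull v) fst (fun x => (x, 0)).
  apply: set_homeo_continuous.
  - by move=> z [].
  - by move=> x vx; split.
  - by move=> [x t] [_ /= ->].
  - by [].
  - by move=> z _; exact: cvg_fst.
  - move=> x _; apply: continuous_at_pair; first exact: continuous_at_id.
    exact: continuous_at_cst.
split; first exact: locally_compact_homeo h lX.
by have := has_chi_homeo h cX; rewrite mulr1.
Qed.

Lemma complex_chi_realization K : generalized_complex K ->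
  locally_compact_set (realization K) ->
  has_chi (realization K) (complex_euler_char K).
Proof.
move=> cK lK; rewrite -[complex_euler_char K]mulr1.
apply: (map_to_complex_chi (q := id)) => // [|s d Ks ds].
  by apply: continuous_subspaceT => x; exact: cvg_id.
rewrite mulr1; have [_ cs] := open_simplex_chi ds.
suff -> : realization K `&` id @^-1` s = s by [].
by apply/seteqP; split=> [x [] //|x sx]; split=> //; exists s.
Qed.

(* By homogeneity along open simplices, and as the simplices of maximal dimension
   are open in the realization. *)
Lemma locally_compact_part_complex K : generalized_complex K ->
  exists L, [/\ L `<=` K, realization L = locally_compact_part (realization K),
    realization (K `\` L) = realization K `\` locally_compact_part (realization K) &
    K !=set0 -> L !=set0].
Proof.
move=> cK; set P := locally_compact_part _.
pose L := [set s | K s /\ s `<=` P].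
have homog s x : K s -> s x -> P x -> s `<=` P.
  move=> Ks sx [_ lx] y sy; split; first by exists s.
  exact: locally_compact_at_translate lx (complex_homogeneous cK Ks sx sy).
exists L; split.
- by move=> s [].
- apply/seteqP; split=> x; first by move=> [s [Ks sP] /sP].
  by move=> Px; have [[s Ks sx] _] := Px; exists s => //; split=> //; exact: homog Px.
- apply/seteqP; split=> x.
    move=> [s [Ks nLs] sx]; split; first by exists s.
    by move=> Px; apply: nLs; split=> //; exact: homog Px.
  by move=> [[s Ks sx] nPx]; exists s => //; split=> // -[_ /(_ _ sx)].
- move=> /(complex_max_simplex cK)[s [d [Ks ds dmax]]]; exists s; split=> //.
  have [x sx] := open_simplex_nonempty ds.
  apply: (homog s x Ks sx); split; first by exists s.
  have [B Bx HB] := max_simplex_nbhs cK Ks ds dmax sx.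
  have [C [U [cC Cs Ux UC]]] := (open_simplex_chi ds).1 x sx.
  exists C, (U `&` B); split=> //.
  + by move=> y /Cs sy; exists s.
  + exact: filterI.
  + move=> y [[Uy By] [t Kt ty]]; apply: UC; split=> //.
    have [<- //|ts] := eqVneq t s.
    by have : (t `&` B) y by []; rewrite HB.
Qed.

End LocallyCompactPartOfComplex.

(* Trivializations are only required over neighbourhoods of the open simplices
   of the base, not over a neighbourhood of every point of their closures. *)
Definition trivial_over_simplices (R : realType) (S T : normedModType R) (m : nat)
    (M : set (set 'rV[R]_m)) (X : set S) (Y : set T) (p : S -> 'rV[R]_m) : Prop :=
  forall s, M s -> exists W f g, [/\ s `<=` W, W `<=` realization M,
    forall b, W b -> exists2 B, nbhs b B & B `&` realization M `<=` W,
    set_homeo (X `&` p @^-1` W) (W `*` Y) f g &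
    forall x, X x -> W (p x) -> (f x).1 = p x].

Section BundleOverComplex.
Variables (R : realType) (m : nat) (M : set (set 'rV[R]_m)).
Hypotheses (cM : generalized_complex M) (compM : compact (realization M)).

Section Restriction.
Variables (S T : normedModType R) (X : set S) (Y : set T) (p : S -> 'rV[R]_m).
Hypotheses (cp : {within X, continuous p}).
Hypothesis triv : trivial_over_simplices M X Y p.

Lemma trivial_over_restrict X' Y' : X' `<=` X -> Y' `<=` Y ->
  (forall W f g x, W `<=` realization M ->
    (forall b, W b -> exists2 B, nbhs b B & B `&` realization M `<=` W) ->
    set_homeo (X `&` p @^-1` W) (W `*` Y) f g -> X x -> W (p x) ->
    (f x).1 = p x -> X' x <-> Y' (f x).2) ->
  trivial_over_simplices M X' Y' p.
Proof.
move=> XX YY E s Ms; have [W [f [g [sW WM oW h fp]]]] := triv Ms.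
exists W, f, g; split=> //; last by move=> x /XX; exact: fp.
apply: (set_homeo_restrict h).
- by move=> x [/XX ? ?].
- by move=> z [? /YY ?].
- move=> x [Xx Wpx]; have fpx := fp x Xx Wpx.
  have H := E W f g x WM oW h Xx Wpx fpx; split=> [[X'x _]|[_ Y'fx]].
    by split; [rewrite fpx|apply/H].
  by split=> //; apply/H.
Qed.

Lemma trivialization_locally_compact_at W f g x : W `<=` realization M ->
  (forall b, W b -> exists2 B, nbhs b B & B `&` realization M `<=` W) ->
  set_homeo (X `&` p @^-1` W) (W `*` Y) f g -> X x -> W (p x) ->
  (forall x, X x -> realization M (p x)) ->
  (f x).1 = p x -> locally_compact_at X x <-> locally_compact_at Y (f x).2.
Proof.
move=> WM oW h Xx Wpx pM fpx.
have lM : locally_compact_set (realization M).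
  by move=> b Mb; exists (realization M), setT; split=> //; exact: filterT.
have lW : locally_compact_set W.
  by apply: locally_compact_open lM WM oW; exact: uniform_regular.
have XWx : (X `&` p @^-1` W) x by [].
have oX : exists2 U, nbhs x U & U `&` X `<=` X `&` p @^-1` W.
  have [B Bx BW] := oW (p x) Wpx.
  exists [set z | X z -> B (p z)].
    by have /subspace_continuousP/(_ x Xx _ Bx) := cp.
  by move=> z [XB Xz]; split=> //; apply: BW; split; [exact: XB|exact: pM].
rewrite (locally_compact_at_open (@uniform_regular _) (@subIsetl _ X _) XWx oX).
rewrite -(locally_compact_at_setX Y (f x).2 (lW _ Wpx) Wpx) -fpx -surjective_pairing.
split; first exact: (locally_compact_at_homeo h XWx).
have [XY YX fK _ _] := h.
move/(locally_compact_at_homeo (set_homeo_sym h) (XY _ XWx)).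
by rewrite fK.
Qed.

(** Over an open simplex [s] of dimension d the total space is s x Y, whose characteristic is (-1)^d
    c. *)
Lemma bundle_chi c : locally_compact_set X -> locally_compact_set Y ->
  has_chi Y c -> (forall x, X x -> realization M (p x)) ->
  has_chi X (complex_euler_char M * c).
Proof.
move=> lX lY cY pM; apply: (map_to_complex_chi (q := p)) => // s d Ms ds.
have [W [f [g [sW WM oW h fp]]]] := triv Ms.
have [v [vi sE]] := ds.
have [_ cX] := open_hull_chi vi lY cY.
apply: has_chi_homeo cX; apply: set_homeo_sym.
apply: (set_homeo_restrict h).
- by move=> x [Xx /sW ?].
- by move=> z [z1 z2]; split=> //; apply: sW; rewrite sE.
- move=> x [Xx Wpx]; rewrite -sE /= fp //; split=> [[_ sx]|[sx _]]; split=> //.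
  by have [XY _ _ _ _] := h; have [] := XY x (conj Xx Wpx).
Qed.

End Restriction.

Lemma bundle_complex_euler_char (n e : nat) (K : set (set 'rV[R]_e))
    (L : set (set 'rV[R]_n)) (p : 'rV[R]_e -> 'rV[R]_m) :
  generalized_complex K -> generalized_complex L ->
  {within realization K, continuous p} ->
  (forall x, realization K x -> realization M (p x)) ->
  trivial_over_simplices M (realization K) (realization L) p ->
  complex_euler_char K = complex_euler_char M * complex_euler_char L.
Proof.
have [l] := ubnP #|` fset_set L|; elim: l => // l IHl in K L *.
move=> Ll cK cL cp pM triv.
have [L0|/set0P Ln0] := eqVneq L set0.
  rewrite L0 complex_euler_char0 mulr0.
  suff -> : K = set0 by rewrite complex_euler_char0.
  apply/seteqP; split=> // s Ks; case: (cK) => _ sK _.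
  have [d /open_simplex_nonempty[x sx]] := sK s Ks.
  have Kx : realization K x by exists s.
  have [t Mt tpx] := pM x Kx.
  have [W [f [g [sW WM oW [XY _ _ _ _] fp]]]] := triv t Mt.
  have [_ [u]] := XY x (conj Kx (sW _ tpx)).
  by rewrite L0.
have [K0 [K0K K0E K1E _]] := locally_compact_part_complex cK.
have [L1 [L1L L1E L2E /(_ Ln0)[s0 L1s0]]] := locally_compact_part_complex cL.
have fK : finite_set K by case: cK.
have fL : finite_set L by case: cL.
have lc_iff W f g x : W `<=` realization M ->
    (forall b, W b -> exists2 B, nbhs b B & B `&` realization M `<=` W) ->
    set_homeo (realization K `&` p @^-1` W) (W `*` realization L) f g ->
    realization K x -> W (p x) -> (f x).1 = p x ->
    locally_compact_part (realization K) x <->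
    locally_compact_part (realization L) (f x).2.
  move=> WM oW h Kx Wpx fpx.
  have lc := trivialization_locally_compact_at cp WM oW h Kx Wpx pM fpx.
  have [XY _ _ _ _] := h; have [_ Lfx] := XY x (conj Kx Wpx).
  by split=> -[_ /lc].
have regS := @uniform_regular 'rV[R]_e; have regT := @uniform_regular 'rV[R]_n.
have PK : locally_compact_part (realization K) `<=` realization K by move=> x [].
have PL : locally_compact_part (realization L) `<=` realization L by move=> x [].
have chiK0 : has_chi (realization K0) (complex_euler_char M * complex_euler_char L1).
  have lL1 : locally_compact_set (realization L1).
    by rewrite L1E; exact: locally_compact_part_locally_compact.
  apply: (@bundle_chi _ _ _ (realization L1) p) => //.
  - by apply: continuous_subspaceW cp; rewrite K0E.
  - by rewrite K0E L1E; apply: (trivial_over_restrict triv) => // W f g x *;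
    exact: lc_iff.
  - by rewrite K0E; exact: locally_compact_part_locally_compact.
  - exact: complex_chi_realization (sub_generalized_complex cL L1L) lL1.
  - by rewrite K0E => x /PK/pM.
(* The characteristic of |K0| is computed twice, by the bundle and by its own simplices. *)
have E0 : complex_euler_char K0 = complex_euler_char M * complex_euler_char L1.
  apply: has_chi_uniq chiK0; apply: complex_chi_realization.
    exact: sub_generalized_complex cK K0K.
  by rewrite K0E; exact: locally_compact_part_locally_compact.
(* The induction hypothesis applies since [L1] is nonempty, so fewer simplices remain in the
   fiber. *)
have E1 : complex_euler_char (K `\` K0) =
    complex_euler_char M * complex_euler_char (L `\` L1).
  apply: (IHl _ _ _ _ _ _ _ _).
  - rewrite fset_setD //; last exact: sub_finite_set fL.
    rewrite -ltnS (leq_trans _ Ll) // ltnS.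
    rewrite -[leqRHS](cardfsID (fset_set L1)) -add1n leq_add2r cardfs_gt0.
    apply/fset0Pn; exists s0; rewrite in_fsetI !in_fset_set ?mem_set //.
      exact: L1L.
    exact: sub_finite_set fL.
  - by apply: sub_generalized_complex cK _ => s [].
  - by apply: sub_generalized_complex cL _ => s [].
  - by apply: continuous_subspaceW cp; rewrite K1E => x [].
  - by rewrite K1E => x [/pM].
  - rewrite K1E L2E; apply: (trivial_over_restrict triv).
    + by move=> x [].
    + by move=> x [].
    + move=> W f g x WM oW h Kx Wpx fpx; have H := lc_iff W f g x WM oW h Kx Wpx fpx.
      have [XY _ _ _ _] := h; have [_ Lfx] := XY x (conj Kx Wpx).
      by split=> -[_ nP]; split=> // /H.
by rewrite (complex_euler_charID fK K0K) (complex_euler_charID fL L1L) mulrDr E0 E1.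
Qed.

End BundleOverComplex.

(** * Definable spaces *)

Section DefinableHalfSpaces.
Variables (R : realType) (S : o_minimal_structure R).

Lemma definable_setT n : definable S [set: 'rV[R]_n].
Proof. by rewrite -setC0; exact/definable_setC/definable_set0. Qed.

Lemma definable_setI n (A B : set 'rV[R]_n) :
  definable S A -> definable S B -> definable S (A `&` B).
Proof.
move=> dA dB; rewrite -[A `&` B]setCK setCI.
by apply/definable_setC/definable_setU; exact: definable_setC.
Qed.

Lemma definable_half_space n (i : 'I_n) (c : R) :
  definable S [set x : 'rV[R]_n | x 0 i < c].
Proof.
have d1 : definable S [set x : 'rV[R]_1 | x 0 0 < c].
  apply/definable_line; exists [set [set t | t < c]]; split.
  - exact: finite_set1.
  - move=> _ ->; right; exists -oo%E, c%:E; apply/seteqP; split=> t /=.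
      by rewrite ltNyr lte_fin.
    by rewrite lte_fin => -[].
  - rewrite bigcup_set1; apply/seteqP; split=> [_ [x xc <-] //|t tc].
    by exists (const_mx t); rewrite /= mxE.
have [j [k [e ij]]] : exists j k, (j + (1 + k) = n)%N /\ i = j :> nat.
  by exists (nat_of_ord i), (n - i.+1)%N; rewrite addnA addn1 subnKC.
(* With [n] literally [j + (1 + k)], the half-space is a product of R^j, a ray and R^k without
   casts. *)
move: i ij; case: n / e => i ij.
have -> : i = rshift j (lshift k (0 : 'I_1)) by apply: val_inj; rewrite /= addn0.
have := definable_setX (definable_setT j) (definable_setX d1 (definable_setT k)).
congr (definable S); apply/seteqP; split=> x /=.
  by move=> [_ [+ _]]; rewrite !mxE.
by move=> xc; split=> //; split=> //; rewrite !mxE.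
Qed.

End DefinableHalfSpaces.

(** * From homeomorphisms of subtypes to maps between subsets *)

Section Transport.

Lemma within_continuous_comp (S T U : topologicalType) (X : set S) (Y : set T)
    (f : S -> T) (g : T -> U) : (forall x, X x -> Y (f x)) ->
  {within X, continuous f} -> {within Y, continuous g} ->
  {within X, continuous (g \o f)}.
Proof.
move=> XY /subspace_continuousP cf /subspace_continuousP cg.
apply/subspace_continuousP => x Xx O /(cg (f x) (XY x Xx)) gO.
have fgO : nbhs x [set z | X z -> Y (f z) -> O (g (f z))] := cf x Xx _ gO.
suff : nbhs x [set z | X z -> O (g (f z))] by [].
by apply: filterS fgO => z /= H Xz; apply: H => //; exact: XY.
Qed.

Lemma set_homeo_comp (S T U : topologicalType) (X : set S) (Y : set T) (Z : set U)
    f f' g g' : set_homeo X Y f f' -> set_homeo Y Z g g' ->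
  set_homeo X Z (g \o f) (f' \o g').
Proof.
move=> [XY YX fK f'K [cf cf']] [YZ ZY gK g'K [cg cg']]; split=> //=.
- by move=> x /XY/YZ.
- by move=> z /ZY/YX.
- by move=> x Xx; rewrite gK ?fK //; exact: XY.
- by move=> z Zz; rewrite f'K ?g'K //; exact: ZY.
- by split; apply: within_continuous_comp; eauto.
Qed.

Lemma set_homeo_prod (S S' T T' : topologicalType) (X : set S) (X' : set S')
    (Y : set T) (Y' : set T') f f' g g' :
  set_homeo X X' f f' -> set_homeo Y Y' g g' ->
  set_homeo (X `*` Y) (X' `*` Y')
    (fun z => (f z.1, g z.2)) (fun z => (f' z.1, g' z.2)).
Proof.
have cont (A B A' B' : topologicalType) (Z : set A) (Z' : set A') (h : A -> B)
    (h' : A' -> B') : {within Z, continuous h} -> {within Z', continuous h'} ->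
  {within Z `*` Z', continuous (fun z => (h z.1, h' z.2))}.
  move=> /subspace_continuousP ch /subspace_continuousP ch'.
  apply/subspace_continuousP => -[a a'] [/= Za Za'] O [[P P'] /= [Pa Pa'] PO].
  exists ([set z | Z z -> P (h z)], [set z | Z' z -> P' (h' z)]).
    by split; [exact: ch Za _ Pa|exact: ch' Za' _ Pa'].
  move=> [b b'] [/= Hb Hb'] [/= Zb Zb']; apply: PO; split=> /=.
    exact: Hb.
  exact: Hb'.
move=> [XX' X'X fK f'K [cf cf']] [YY' Y'Y gK g'K [cg cg']]; split.
- by move=> z [/XX' ? /YY' ?].
- by move=> z [/X'X ? /Y'Y ?].
- by move=> [x y] [/= Xx Yy]; rewrite fK ?gK.
- by move=> [x y] [/= Xx Yy]; rewrite f'K ?g'K.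
- by split; exact: cont.
Qed.

Lemma nbhs_set_type (T : topologicalType) (A : set T) (x : set_type A)
    (P : set (set_type A)) : nbhs x P ->
  exists2 O, nbhs (set_val x) O & forall y, O (set_val y) -> P y.
Proof.
move=> [_ [[V oV <-] /= Vx VP]]; exists V => //.
by apply: open_nbhs_nbhs.
Qed.

Lemma set_val_continuous (T : topologicalType) (A : set T) :
  continuous (set_val : set_type A -> T).
Proof. exact: initial_continuous. Qed.

(* Extension by the junk value [u0] outside of [A]. *)
Definition extend (T U : Type) (A : set T) (f : set_type A -> U) (u0 : U)
    (x : T) : U :=
  if pselect (A x) is left Ax then f (exist _ x (mem_set Ax)) else u0.

Lemma extendE (T U : Type) (A : set T) (f : set_type A -> U) u0 (x : set_type A) :
  extend f u0 (set_val x) = f x.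
Proof.
rewrite /extend; case: pselect => [Ax|]; last by case; exact: set_valP.
by congr f; apply: val_inj.
Qed.

Lemma extend_continuous (T U : topologicalType) (A : set T) (f : set_type A -> U) u0 :
  continuous f -> {within A, continuous (extend f u0)}.
Proof.
move=> cf; apply/subspace_sigL_continuousP.
suff -> : sigL A (extend f u0) = f by [].
by apply/funext => x; rewrite -[LHS]/(extend f u0 (set_val x)) extendE.
Qed.

Lemma homeomorphic_set_homeo (X T : topologicalType) (A : set T) (x0 : X) :
  homeomorphic X (set_type A) -> exists f g, set_homeo [set: X] A f g.
Proof.
move=> [f [g [fK gK cf cg]]]; exists (set_val \o f), (extend g x0); split.
- by move=> x _; exact: set_valP.
- by [].
- by move=> x _; rewrite /= extendE fK.
- move=> y Ay; have -> : y = set_val (exist _ y (mem_set Ay) : set_type A) by [].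
  by rewrite /= extendE gK.
- split; last exact: extend_continuous.
  apply: continuous_subspaceT => x; apply: (continuous_comp (cf x)).
  exact: set_val_continuous.
Qed.

Lemma trivialization_set_homeo (E B F : topologicalType) (p : E -> B) (U : set B)
    (h : set_type (p @^-1` U) -> (set_type U * F)%type) (e0 : E) (f0 : F) :
  homeomorphism h -> (forall e, set_val (h e).1 = p (set_val e)) ->
  exists f g, set_homeo (p @^-1` U) (U `*` [set: F]) f g /\
    forall e, U (p e) -> (f e).1 = p e.
Proof.
move=> [h' [hK h'K ch ch']] hp.
pose f := extend (fun e => (set_val (h e).1, (h e).2)) (p e0, f0).
pose g (z : B * F) : E := extend (fun u => set_val (h' (u, z.2))) e0 z.1.
have fE (e : set_type (p @^-1` U)) : f (set_val e) = (set_val (h e).1, (h e).2).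
  exact: extendE.
have gE (u : set_type U) y : g (set_val u, y) = set_val (h' (u, y)).
  by rewrite /g /= extendE.
have asE e : U (p e) -> exists e' : set_type (p @^-1` U), e = set_val e'.
  by move=> Ue; exists (exist _ e (mem_set Ue)).
have asU u : U u -> exists u' : set_type U, u = set_val u'.
  by move=> Uu; exists (exist _ u (mem_set Uu)).
exists f, g; split; last by move=> _ /asE[e ->]; rewrite fE /= hp.
split.
- by move=> _ /asE[e ->]; rewrite fE; split=> //=; exact: set_valP.
- by move=> [_ y] [/= /asU[u ->] _]; rewrite gE; exact: (set_valP (h' (u, y))).
- move=> _ /asE[e ->]; rewrite fE gE.
  by rewrite -surjective_pairing hK.
- by move=> [_ y] [/= /asU[u ->] _]; rewrite gE fE h'K.
- split.
    have cpair e : {for e, continuous (fun e => (set_val (h e).1, (h e).2))}.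
      apply: continuous_at_pair; last exact/continuous_at_snd/ch.
      apply: (@continuous_at_comp _ _ _ (fun e => (h e).1) set_val).
        exact/continuous_at_fst/ch.
      exact: set_val_continuous.
    exact: extend_continuous.
  apply/subspace_continuousP => -[_ y] [/= /asU[u ->] _] O.
  move=> Og; have {}Og : nbhs (set_val (h' (u, y))) O by rewrite -gE.
  have := continuous_comp (ch' (u, y)) (@set_val_continuous _ _ _) Og.
  move=> [[P Q] /= [Pu Qy] PQ].
  have [V Vu VP] := nbhs_set_type Pu.
  suff : nbhs (set_val u, y) [set z | (U `*` [set: F]) z -> O (g z)] by [].
  exists (V, Q) => //= -[w' z] [/= Vw Qz] [/= /asU[w wE] _].
  rewrite wE in Vw *; rewrite gE; apply: (PQ (w, z)); split=> //=.
  exact: VP.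
Qed.

End Transport.

(* A triangulation compatible with a fine grid of half-spaces has small open
   simplices. *)
Lemma fine_triangulation (R : realType) (S : o_minimal_structure R) (n : nat)
    (D : set 'rV[R]_n) (e : R) :
  definable_triangulation_theorem S -> definable S D -> compact D -> 0 < e ->
  exists (N : nat) (M : set (set 'rV[R]_N))
      (h : set_type (realization M) -> set_type D),
    definable_triangulation S h /\
    forall s x y, M s -> s (set_val x) -> s (set_val y) ->
      ball (set_val (h x)) e (set_val (h y)).
Proof.
move=> tri dD cD e0.
have [b b0 Db] : exists2 b : R, 0 < b & forall x, D x -> forall i, `|x 0 i| <= b.
  have [B [_ HB]] := compact_bounded cD.
  exists (`|B| + 1); first by have := normr_ge0 B; lra.
  move=> x Dx i; have : `|B| + 1 > B by have := ler_norm B; lra.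
  move=> /HB /(_ x Dx); apply: le_trans.
  rewrite -[X in _ <= X]/(mx_norm x) mx_normrE.
  exact: (le_bigmax _ (fun ij : 'I_1 * 'I_n => `|x ij.1 ij.2|) (0, i)).
(* The levels of the grid start at the lower bound -b of all coordinates and are e/2 apart; [J] is
   chosen so that they pass the upper bound b. *)
pose c (j : nat) : R := - b + j%:R * (e / 2).
have e2 : 0 < e / 2 by rewrite divr_gt0.
have [J bJ] : exists J, b < c J.
  exists (Num.bound ((b + b) / (e / 2))).
  rewrite /c -ltrBlDl opprK -ltr_pdivrMr //; apply: archi_boundP.
  by rewrite divr_ge0 ?addr_ge0 // ltW.
pose H (ij : 'I_n * 'I_J.+1) := D `&` [set x | x 0 ij.1 < c ij.2].
have [|A [ij _ <-]|N [M [h [hM compat]]]] := tri n D (range H) dD.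
- exact: finite_image.
- split; first by apply: definable_setI => //; exact: definable_half_space.
  by move=> x [].
exists N, M, h; split=> // s x y Ms sx sy.
have [cM [h' [hK _ _ _]] _] := hM.
have same u w ij : s (set_val u) -> s (set_val w) ->
    H ij (set_val (h u)) -> H ij (set_val (h w)).
  move=> su sw; have [L [LM ->]] := compat (H ij) (imageT H ij).
  move=> [t Lt [u' tu' /val_inj/(can_inj hK) uu']].
  have ts : t = s by apply: (complex_disjoint cM (LM t Lt) Ms tu'); rewrite uu'.
  by exists t => //; exists w => //=; rewrite ts.
have close u w i : s (set_val u) -> s (set_val w) ->
    (set_val (h w) : 'rV[R]_n) 0 i - (set_val (h u) : 'rV[R]_n) 0 i < e.
  move=> su sw; set z := set_val (h u).
  have Dz : D z by exact: set_valP.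
  have ex : exists j, z 0 i < c j.
    by exists J; apply: le_lt_trans bJ; apply: le_trans (Db z Dz i); exact: ler_norm.
  (* The least level above the coordinate of [z] is not the bottom one, so it exceeds this
     coordinate by at most e/2. By [same] the other point lies below this level too. *)
  case: (ex_minnP ex) => j zj jmin.
  have jJ : (j < J.+1)%N.
    rewrite ltnS; apply: jmin; apply: le_lt_trans bJ.
    by apply: le_trans (Db z Dz i); exact: ler_norm.
  have [_ /=] := same u w (i, Ordinal jJ) su sw (conj Dz zj).
  case: j => [|j] in zj jmin jJ *.
    have := Db z Dz i; rewrite ler_norml => /andP[zb _].
    by move: zj; rewrite /c mul0r addr0 ltNge zb.
  have : c j <= z 0 i.
    by rewrite leNgt; apply/negP => /jmin; rewrite ltnn.
  have -> : c j.+1 = c j + e / 2 by rewrite /c -natr1 mulrDl mul1r addrA.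
  move=> h1 h2; lra.
split=> // i j; rewrite ord1 -ball_normE /= ltr_norml.
have := close x y j sx sy; have := close y x j sy sx; lra.
Qed.

Lemma homeomorphism_set_homeo (S T : topologicalType) (X : set S) (Y : set T)
    (h : set_type X -> set_type Y) (x0 : S) (y0 : T) : homeomorphism h ->
  exists f g, set_homeo X Y f g /\ forall x, f (set_val x) = set_val (h x).
Proof.
move=> [h' [hK h'K ch ch']].
exists (extend (set_val \o h) y0), (extend (set_val \o h') x0).
split; last by move=> x; rewrite extendE.
have asX x : X x -> exists x' : set_type X, x = set_val x'.
  by move=> Xx; exists (exist _ x (mem_set Xx)).
have asY y : Y y -> exists y' : set_type Y, y = set_val y'.
  by move=> Yy; exists (exist _ y (mem_set Yy)).
split.
- by move=> _ /asX[x ->]; rewrite extendE; exact: set_valP (h x).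
- by move=> _ /asY[y ->]; rewrite extendE; exact: set_valP (h' y).
- by move=> _ /asX[x ->]; rewrite !extendE /= hK.
- by move=> _ /asY[y ->]; rewrite !extendE /= h'K.
- split; apply: extend_continuous => x.
    by apply: (continuous_comp (ch x)); exact: set_val_continuous.
  by apply: (continuous_comp (ch' x)); exact: set_val_continuous.
Qed.

Lemma complex_euler_char_empty (R : realType) (N : nat) (K : set (set 'rV[R]_N)) :
  generalized_complex K -> realization K = set0 -> complex_euler_char K = 0.
Proof.
move=> [_ sK _] K0; suff -> : K = set0 by exact: complex_euler_char0.
apply/seteqP; split=> // s Ks; have [d /open_simplex_nonempty[x sx]] := sK s Ks.
have : realization K x by exists s.
by rewrite K0.
Qed.

(** * The bundle as a map between realizations *)

Section BundleTransport.
Variables (R : realType) (E B F : topologicalType) (p : E -> B).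

Definition trivializing_open (U : set B) : Prop :=
  open U /\ exists h : set_type (p @^-1` U) -> (set_type U * F)%type,
    homeomorphism h /\ forall e, set_val (h e).1 = p (set_val e).

Variables (n e m : nat) (K : set (set 'rV[R]_e)) (L : set (set 'rV[R]_n)).
Variable M : set (set 'rV[R]_m).
Variables (fE : E -> 'rV[R]_e) (gE : 'rV[R]_e -> E).
Variables (fB : B -> 'rV[R]_m) (gB : 'rV[R]_m -> B).
Variables (fF : F -> 'rV[R]_n) (gF : 'rV[R]_n -> F) (e0 : E) (f0 : F).
Hypotheses (hE : set_homeo [set: E] (realization K) fE gE)
  (hB : set_homeo [set: B] (realization M) fB gB)
  (hF : set_homeo [set: F] (realization L) fF gF).

Lemma transport_trivial_over_simplices :
  (forall s, M s -> exists2 U, trivializing_open U & forall y, s y -> U (gB y)) ->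
  trivial_over_simplices M (realization K) (realization L) (fB \o p \o gE).
Proof.
move=> small s Ms; have [U [oU [h [hh hp]]] sU] := small s Ms.
have [f1 [g1 [h1 f1p]]] := trivialization_set_homeo e0 f0 hh hp.
have [EK KE fEK gEK _] := hE.
have [BM MB fBK gBK [_ cgB]] := hB.
have [FL LF fFK gFK _] := hF.
have fB_inj b b' : fB b = fB b' -> b = b'.
  by move=> bb; rewrite -(fBK b) // bb fBK.
pose W := fB @` U.
have WU b : W (fB b) -> U b by move=> [b' Ub' /fB_inj <-].
have WM : W `<=` realization M by move=> _ [b _ <-]; exact: BM.
have hX : set_homeo (realization K `&` (fB \o p \o gE) @^-1` W) (p @^-1` U) gE fE.
  apply: (set_homeo_restrict (set_homeo_sym hE)) => // x Kx.
  split=> [[_ /= /WU//]|Up]; split=> //.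
  by exists (p (gE x)).
have hW : set_homeo U W fB gB.
  apply: (set_homeo_restrict hB) => // b _.
  by split=> [Ub|/WU//]; exists b.
have hZ := set_homeo_comp (set_homeo_comp hX h1) (set_homeo_prod hW hF).
exists W; do 2 eexists; split; [| |  |exact: hZ|].
- by move=> y sy; exists (gB y); [exact: sU|apply: gBK; exists s].
- exact: WM.
- move=> _ [b Ub <-].
  have Mb : realization M (fB b) by exact: BM.
  have gBb : nbhs (gB (fB b)) U.
    by rewrite fBK //; exact: open_nbhs_nbhs.
  have /subspace_continuousP/(_ _ Mb _ gBb) := cgB.
  move=> V; exists [set z | realization M z -> U (gB z)]; first exact: V.
  by move=> z [Vz Mz]; exists (gB z); [exact: Vz|exact: gBK].
- by move=> x Kx Wx; rewrite /= f1p //; exact: WU.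
Qed.

Lemma transport_continuous : continuous p ->
  {within realization K, continuous (fB \o p \o gE)}.
Proof.
move=> cp; have [_ _ _ _ [_ cgE]] := hE; have [_ _ _ _ [cfB _]] := hB.
apply: (within_continuous_comp (Y := [set: E])) => //.
apply: (within_continuous_comp (Y := [set: B])) => //.
exact: continuous_subspaceT.
Qed.

End BundleTransport.

Theorem theorem4p2 (R : realType) (S : o_minimal_structure R)
    (triangulation : definable_triangulation_theorem S)
    (invariance : euler_char_invariance S)
    (E B F : topologicalType) (p : E -> B)
    (bundle : locally_trivial_bundle F p)
    (definable_E : homeomorphic_to_definable S E)
    (definable_B : homeomorphic_to_definable S B)
    (definable_F : homeomorphic_to_definable S F)
    (compact_B : compact [set: B]) :
  euler_char S E = euler_char S B * euler_char S F.
Proof.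
have [nE [AE [dE homE]]] := definable_E.
have [nB [AB [dB homB]]] := definable_B.
have [nF [AF [dF homF]]] := definable_F.
have [NE [K [hK [tK _]]]] := triangulation nE AE set0 dE (finite_set0 _) (fun
  _ => False_ind _).
have [NF [L [hL [tL _]]]] := triangulation nF AF set0 dF (finite_set0 _) (fun
  _ => False_ind _).
have [cK hKh _] := tK; have [cL hLh _] := tL.
have chiE : euler_char S E = complex_euler_char K.
  by apply: euler_charE homE _ => //; exists NE, K, hK.
have chiF : euler_char S F = complex_euler_char L.
  by apply: euler_charE homF _ => //; exists NF, L, hL.
have EK : homeomorphic E (set_type (realization K)).
  by apply: homeomorphic_trans homE _; apply: homeomorphic_sym; exists hK.
have FL : homeomorphic F (set_type (realization L)).
  by apply: homeomorphic_trans homF _; apply: homeomorphic_sym; exists hL.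
have cAB : compact AB.
  have [f [g [fK gK cf cg]]] := homB.
  have -> : AB = (set_val \o f) @` [set: B].
    apply/seteqP; split=> [x Ax|_ [b _ <-]]; last exact: (set_valP (f b)).
    by exists (g (exist _ x (mem_set Ax))) => //=; rewrite gK.
  apply: continuous_compact => //; apply: continuous_subspaceT => b.
  by apply: (continuous_comp (cf b)); exact: set_val_continuous.
have chiB (N : nat) (M : set (set 'rV[R]_N)) (h : set_type (realization M) ->
  set_type AB) :
    definable_triangulation S h -> euler_char S B = complex_euler_char M.
  by move=> tM; apply: euler_charE homB _ => //; exists N, M, h.
have [cp triv] := bundle.
(* A point of E yields a point of F and the default values needed to extend maps from subtypes. If E
   is empty, then F or B is empty and both sides are 0. *)
have [[e0]|nE0] := pselect (exists e0 : E, True); last first.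
  have K0 : complex_euler_char K = 0.
    apply: complex_euler_char_empty => //; apply/seteqP; split=> // x Kx.
    have [_ [g _]] := EK; apply: nE0.
    by exists (g (exist _ x (mem_set Kx))).
  rewrite chiE K0; symmetry; apply/eqP; rewrite mulf_eq0; apply/orP.
  have [[f0 _]|nF0] := pselect (exists f0 : F, True); last first.
    right; rewrite chiF; apply/eqP; apply: complex_euler_char_empty => //.
    apply/seteqP; split=> // x Lx; have [_ [g _]] := FL; apply: nF0.
    by exists (g (exist _ x (mem_set Lx))).
  (* Any triangulation of the base will do here, with 1 as an arbitrary mesh. A point of B and [f0]
     would give a point of E through a trivialization. *)
  left; have [N [M [h [tM _]]]] := fine_triangulation triangulation dB cAB (@ltr01 R).
  have [cM hMh _] := tM.
  rewrite (chiB _ _ _ tM); apply/eqP; apply: complex_euler_char_empty => //.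
  apply/seteqP; split=> // x Mx; have [g _] := homeomorphic_sym homB.
  have [U [_ Ub [hU [[h' _] _]]]] := triv (g (h (exist _ x (mem_set Mx)))).
  pose u : set_type U := exist (fun b => b \in U) _ (mem_set Ub).
  by apply: nE0; exists (set_val (h' (u, f0))).
move=> _.
have [U0 [_ Ue0 [h0 _]]] := triv (p e0).
have f0 : F := (h0 (exist _ e0 (mem_set Ue0))).2.
have [fE [gE hE]] := homeomorphic_set_homeo e0 EK.
have [fF [gF hF]] := homeomorphic_set_homeo f0 FL.
have [fA [gA hA]] := homeomorphic_set_homeo (p e0) homB.
have [BA AB' fAK gAK [_ cgA]] := hA.
(* [d] is a Lebesgue number, measured in the definable model [AB] of B, for the cover by
   trivializing open sets. *)
have [d d0 Hd] : exists2 d : R, 0 < d & forall x, AB x ->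
    exists2 U, trivializing_open F p U & forall b, ball x d (fA b) -> U b.
  apply: (lebesgue_number (Q := fun O => exists2 U, trivializing_open F p U &
    forall b, O (fA b) -> U b)) => // [V V' VV [U tU HU]|x Ax].
    by exists U => // b /VV/HU.
  have [U [oU Ux [h hh]]] := triv (gA x).
  have Ugx : nbhs (gA x) U by exact: open_nbhs_nbhs.
  have /subspace_continuousP/(_ x Ax _ Ugx) V := cgA.
  exists [set z | AB z -> U (gA z)]; first exact: V.
  exists U; first by split=> //; exists h.
  by move=> b /(_ (BA b I)); rewrite fAK.
(* Only the base needs a fine triangulation; those of E and F are arbitrary. *)
have [N [M [hM [tM small]]]] := fine_triangulation triangulation dB cAB d0.
have [cM hMh _] := tM.
have [fM [gM [hMs fMh]]] := homeomorphism_set_homeo (0 : 'rV[R]_N) (0 :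
  'rV[R]_nB) hMh.
have hB := set_homeo_comp hA (set_homeo_sym hMs).
have [BM MB fBK gBK [cfB _]] := hB.
rewrite chiE chiF (chiB _ _ _ tM).
apply: (@bundle_complex_euler_char _ _ M cM _ _ _ K L ((gM \o fA) \o p \o gE)) => //.
- have -> : realization M = (gM \o fA) @` [set: B].
    apply/seteqP; split=> [x Mx|_ [b _ <-]]; last exact: BM.
    by exists ((gA \o fM) x) => //; exact: gBK.
  exact: continuous_compact.
- exact: (transport_continuous hE hB).
- by move=> x _; exact: BM.
- apply: (transport_trivial_over_simplices e0 f0 hE hB hF) => s Ms.
  have [_ sM _] := cM; have [k /open_simplex_nonempty[x sx]] := sM s Ms.
  have inM y : s y -> exists y' : set_type (realization M), y = set_val y'.
    by move=> sy; have My : realization M y by [exists s];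
      exists (exist _ y (mem_set My)).
  have [x' xE] := inM x sx; have [U tU HU] := Hd _ (set_valP (hM x')).
  exists U => // y sy; have [y' yE] := inM y sy; apply: HU => /=.
  rewrite yE fMh gAK; last exact: (set_valP (hM y')).
  by apply: (small s) => //; rewrite -?xE -?yE.
Qed.
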